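(* Let $T>0$ and fix an integer $p\geq 2$. Let $\{B(t)\}_{t\in[0,T]}$ be a classical (standard) Brownian motion, and let $(F_n)_{n\geq 1}$ be a sequence of multiple Wiener-It\^o integrals of the form \[ F_n=\int_{[0,T]^p} f_n(t_1,\ldots,t_p)\,dB(t_1)\ldots dB(t_p), \] where each $f_n\in L^2([0,T]^p;\mathbb{R})$ is symmetric. Suppose moreover that $E[F_n^2]\to 1$ as $n\to\infty$. Then, as $n\to\infty$, the following two assertions are equivalent: (i) the sequence $(F_n)$ converges in distribution to the standard Gaussian law $N(0,1)$ (the law of $B(1)$); (ii) $E[F_n^4]\to 3$ (the fourth moment of the law $N(0,1)$).
   Context: A classical Brownian motion is a stochastic process on a probability space, starting from $0$, with independent increments, such that $B(t)-B(s)$ is a centered Gaussian random variable with variance $t-s$ for all $t\geq s$. Multiple Wiener-It\^o integral: let $D^p\subset[0,T]^p$ be the set of points $(t_1,\ldots,t_p)$ with $t_i=t_j$ for some $i\neq j$. For $f=\mathbf{1}_A$ with $A=[u_1,v_1]\times\cdots\times[u_p,v_p]\subset[0,T]^p$ and $A\cap D^p=\emptyset$, set $\int_{[0,T]^p} f\,dB\ldots dB=I_p(f)=(B(v_1)-B(u_1))\cdots(B(v_p)-B(u_p))$. Extend by linearity to linear combinations of indicators of disjoint such rectangles, and then to all $f\in L^2([0,T]^p)$ by $L^2$-approximation. One has $E[I_p(f)I_p(g)]=p!\langle \widetilde f,\widetilde g\rangle_{L^2([0,T]^p)}$, where $\widetilde f$ is the symmetrization of $f$. A function is symmetric if it is invariant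 under all permutations of its arguments. *)

(* Defs.v *)
From HB Require Import structures.
From mathcomp Require Import all_boot all_order all_algebra all_fingroup.
From mathcomp Require Import all_classical all_reals all_analysis.
From mathcomp Require Import measurable_realfun.
Import Order.TTheory GRing.Theory Num.Theory.
Import numFieldNormedType.Exports.

Set Implicit Arguments.
Unset Strict Implicit.
Unset Printing Implicit Defensive.

Local Open Scope classical_set_scope.
Local Open Scope ring_scope.

Section power_measure.
Context d (X : measurableType d) (R : realType).
Variable m : {finite_measure set X -> \bar R}.

Definition tuple_cons n (xt : X * n.-tuple X) : n.+1.-tuple X :=
  [tuple of xt.1 :: xt.2].

Lemma measurable_tuple_cons n : measurable_fun [set: _] (@tuple_cons n).
Proof. exact: measurable_cons. Qed.

Section succ.
Variables (n : nat) (mn : {finite_measure set (n.-tuple X) -> \bar R}).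

Definition power_measureS : set (n.+1.-tuple X) -> \bar R :=
  pushforward (m \x mn)%E (@tuple_cons n).

Let power_measureS0 : power_measureS set0 = 0%E.
Proof. by rewrite /power_measureS /pushforward preimage_set0 measure0. Qed.

Let power_measureS_ge0 A : (0 <= power_measureS A)%E.
Proof. exact: (measure_ge0 (m \x mn)%E). Qed.

Let power_measureS_sigma_additive : semi_sigma_additive power_measureS.
Proof.
by apply: measure_semi_sigma_additive; exact: measurable_tuple_cons.
Qed.

HB.instance Definition _ := isMeasure.Build _ _ _ power_measureS
  power_measureS0 power_measureS_ge0 power_measureS_sigma_additive.

Let power_measureS_finite : fin_num_fun power_measureS.
Proof.
apply: lty_fin_num_fun => /=; rewrite /power_measureS /pushforward.
rewrite preimage_setT -setXTT [ltLHS]product_measure1E//.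
by rewrite lte_mul_pinfty ?fin_num_fun_lty//; exact: fin_num_measure.
Qed.

HB.instance Definition _ :=
  Measure_isFinite.Build _ _ _ power_measureS power_measureS_finite.

End succ.

Fixpoint power_measure n : {finite_measure set (n.-tuple X) -> \bar R} :=
  match n with
  | 0 => \d_[tuple]
  | n'.+1 => power_measureS (power_measure n')
  end.

Lemma power_measure_box n (A : 'I_n -> set X) :
  (forall i, measurable (A i)) ->
  power_measure n [set t | forall i, A i (tnth t i)] = (\prod_(i < n) m (A i))%E.
Proof.
elim: n A => [|n IHn] A mA /=.
  by rewrite big_ord0 diracE mem_set//= => -[].
rewrite big_ord_recl -IHn// /power_measureS /pushforward.
have mB : measurable
    [set t : n.-tuple X | forall i, A (lift ord0 i) (tnth t i)].
  rewrite [X in measurable X](_ : _ = \bigcap_(i in [set: 'I_n])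
      ((fun t : n.-tuple X => tnth t i) @^-1` A (lift ord0 i))).
    apply: fin_bigcap_measurable => // i _.
    by rewrite -[X in measurable X]setTI; exact: measurable_tnth.
  by apply/seteqP; split => [t At i _|t At i]; exact: At.
rewrite -product_measure1E//; congr (_ _).
apply/seteqP; split => [[x t]/= At|[x t]/= [Ax At] i].
  by split => [|i]; [exact: (At ord0)|have := At (lift ord0 i); rewrite tnthS].
by case: (unliftP ord0 i) => [j|] ->; [rewrite tnthS|].
Qed.

End power_measure.

Section lebesgue_cube.
Context {R : realType}.

Definition leb : {measure set (measurableTypeR R) -> \bar R} :=
  lebesgue_measure.

Lemma leb_itv_lty (T : R) : (leb `[0%R, T]%classic < +oo)%E.
Proof.
rewrite [ltLHS]lebesgue_measure_itv/=.
by case: ifPn => // _; rewrite -EFinD ltry.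
Qed.

Definition lebesgue_itv (T : R) :
    {finite_measure set (measurableTypeR R) -> \bar R} :=
  @mfrestr _ (measurableTypeR R) R _ leb (measurable_itv `[0, T])
    (leb_itv_lty T).

(* Lebesgue measure on the cube [0, T]^p, seen as a measure on R^p that does
   not charge the complement of the cube; in particular L^2([0, T]^p) is
   [Lfun (lebesgue_cube T p) 2]. *)
Definition lebesgue_cube (T : R) (p : nat) :
    {finite_measure set (p.-tuple (measurableTypeR R)) -> \bar R} :=
  power_measure (lebesgue_itv T) p.

(* Invariance under all permutations of the arguments, as an equality between
   elements of L^2([0, T]^p), hence almost everywhere. *)
Definition symmetric_kernel (T : R) (p : nat) (f : p.-tuple R -> R) :=
  forall s : 'S_p, {ae lebesgue_cube T p,
    forall t, f [tuple tnth t (s i) | i < p] = f t}.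

End lebesgue_cube.

Section brownian_motion.
Context d (Omega : measurableType d) (R : realType) (P : probability Omega R).

(* No quantification over subfamilies is needed, as [A i] may be [setT]. *)
Definition mutually_independent (n : nat) (X : 'I_n -> {RV P >-> R}) :=
  forall A : 'I_n -> set R, (forall i, measurable (A i)) ->
  P (\bigcap_(i in [set: 'I_n]) (X i @^-1` A i)) =
  (\prod_(i < n) P (X i @^-1` A i))%E.

Definition increment (B : R -> {RV P >-> R}) (s t : R) : {RV P >-> R} :=
  (B t \- B s : {mfun Omega >-> R}).

(* The process is indexed by R, but only its restriction to [0, T] is
   constrained.  In [bm_gaussian] the case s = t (zero variance) is left out:
   the increment is then 0, whereas [normal_prob 0 0] is not a Dirac mass. *)
Record brownian_motion (T : R) (B : R -> {RV P >-> R}) : Prop := {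
  bm_start : {ae P, forall w, B 0 w = 0} ;
  bm_independent : forall (n : nat) (t : nat -> R),
    (forall k, (k <= n)%N -> 0 <= t k <= T) ->
    (forall k, (k < n)%N -> t k <= t k.+1) ->
    mutually_independent (fun k : 'I_n => increment B (t k) (t k.+1)) ;
  bm_gaussian : forall s t : R, 0 <= s -> s < t -> t <= T ->
    forall A : set R, measurable A ->
      distribution P (increment B s t) A = normal_prob 0 (Num.sqrt (t - s)) A
}.

End brownian_motion.

Section multiple_integral.
Context {R : realType}.

Definition box (p : nat) (u v : 'I_p -> R) : set (p.-tuple R) :=
  [set t | forall i, u i <= tnth t i <= v i].

Definition diagonal_set (p : nat) : set (p.-tuple R) :=
  [set t | exists i j, i != j /\ tnth t i = tnth t j].

(* A linear combination of indicators of pairwise disjoint closed rectangles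
   of [0, T]^p that do not meet the diagonal. *)
Record simple_kernel (T : R) (p : nat) := SimpleKernel {
  sk_size : nat ;
  sk_coef : 'I_sk_size -> R ;
  sk_lo : 'I_sk_size -> 'I_p -> R ;
  sk_hi : 'I_sk_size -> 'I_p -> R ;
  sk_cube : forall k i,
    [/\ 0 <= sk_lo k i, sk_lo k i <= sk_hi k i & sk_hi k i <= T] ;
  sk_offdiagonal : forall k, box (sk_lo k) (sk_hi k) `&` @diagonal_set p = set0 ;
  sk_disjoint : trivIset setT (fun k => box (sk_lo k) (sk_hi k))
}.

Definition simple_kernel_fun (T : R) (p : nat) (g : simple_kernel T p)
    (t : p.-tuple R) : R :=
  \sum_(k < sk_size g) sk_coef k * \1_(box (sk_lo k) (sk_hi k)) t.

Context d (Omega : measurableType d) (P : probability Omega R).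

Definition simple_integral (B : R -> {RV P >-> R}) (T : R) (p : nat)
    (g : simple_kernel T p) (w : Omega) : R :=
  \sum_(k < sk_size g)
    sk_coef k * \prod_(i < p) (B (sk_hi k i) w - B (sk_lo k i) w).

(* [is_multiple_integral B T f F]: the random variable F is (a version of) the
   multiple Wiener-Ito integral of f over [0, T]^p with respect to B. *)
Definition is_multiple_integral (B : R -> {RV P >-> R}) (T : R) (p : nat)
    (f : p.-tuple R -> R) (F : {RV P >-> R}) :=
  exists g : nat -> simple_kernel T p,
    Lnorm (lebesgue_cube T p) 2%:E
      (fun t => (f t - simple_kernel_fun (g k) t)%:E) @[k --> \oo] --> 0%E /\
    Lnorm P 2%:E
      (fun w => (F w - simple_integral B (g k) w)%:E) @[k --> \oo] --> 0%E.

End multiple_integral.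

Definition cvg_in_distribution d (Omega : measurableType d) (R : realType)
    (P : probability Omega R) (F : nat -> {RV P >-> R})
    (nu : probability (measurableTypeR R) R) :=
  forall phi : R -> R, continuous phi -> bounded_fun phi ->
  ('E_P[phi \o F n] @[n --> \oo] --> \int[nu]_x (phi x)%:E)%E.

(* Main.v *)
(** On a common partition of [0, T], the integral of an off-diagonal simple
    kernel is a homogeneous multilinear polynomial F of degree p in the normalized
    increments, which are independent standard Gaussians.  Put
    Gamma = sum_i (d_i F)^2.  Gaussian integration by parts gives
    p E[F g(F)] = E[Gamma g'(F)], so solving Stein's equation for a continuous
    psi with |psi| <= K and E psi(N) = 0 yields
      (E psi(F))^2 <= (2 K)^2 E[(1 - Gamma / p)^2].
    Expand F^2 = sum_al c_al e_al in products of Hermite polynomials of degree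
    at most 2 in each variable.  Then Gamma = sum_al w_al c_al e_al with
    0 <= w_al <= p, so by orthogonality
      E[Gamma^2] <= p E[Gamma F^2] = (p^2 / 3) E[F^4],
    and therefore (E psi(F))^2 <= (2 K)^2 (1 - 2 E[F^2] + E[F^4] / 3).
    Hypercontractivity, E[F^6] <= (5^p E[F^2])^3, carries this inequality to
    L^2-limits of such F, which gives (ii) => (i); it also makes the F_n^4
    uniformly integrable, which gives (i) => (ii). *)
Require Import Defs.
From HB Require Import structures.
From mathcomp Require Import all_boot all_order all_algebra all_fingroup.
From mathcomp Require Import all_classical all_reals all_analysis.
From mathcomp Require Import measurable_realfun.
From mathcomp Require Import ring lra.
Import Order.TTheory GRing.Theory Num.Theory.
Import numFieldNormedType.Exports.

Set Implicit Arguments.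
Unset Strict Implicit.
Unset Printing Implicit Defensive.

Local Open Scope classical_set_scope.
Local Open Scope ring_scope.

(** Integration by parts with g = x gives E[Gamma] = p E[F^2], so the mean square of 1 - Gamma / p
    is 1 - 2 E[F^2] + E[Gamma^2] / p^2; with g = x^3 it gives p E[F^4] = 3 E[Gamma F^2], which is
    where the fourth moment enters. At variance 1 and fourth moment 3 the final bound is 1 - 2 + 1 =
    0. Off-diagonal rectangles make every monomial square-free. This confines F^2 to Hermite degrees
    at most 2 and lets the weights w_al be found by counting. Gamma is defined only for polynomials
    in finitely many increments, and the partition changes along the approximation. Hence the
    inequality carried to the limit mentions only E psi(F), E[F^2] and E[F^4], each of which is
    shown to pass to L^2-limits. For the fourth moment this takes uniform control of a higher one;
    the sixth is an even power, so it expands algebraically and yields to induction. Stein solutions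
    are not polynomials, so integration by parts is set up for functions of polynomial growth with
    continuous derivative. *)

Section real_derivatives.
Context {R : realType}.

Lemma is_derive_continuous (g g' : R -> R) :
  (forall x : R, is_derive x 1 g (g' x)) -> continuous g.
Proof.
by move=> dg x; apply: differentiable_continuous; exact/derivable1_diffP.
Qed.

Lemma is_derive_exprS (k : nat) (x : R) :
  is_derive x 1 (fun y : R => y ^+ k.+1) (k.+1%:R * x ^+ k).
Proof.
have -> : (fun y : R => y ^+ k.+1) = (id : R -> R) ^+ k.+1.
  by apply/funext => y; rewrite fctE.
by apply: (is_derive_eq (is_deriveX k.+1 (is_derive_id x 1))); rewrite /GRing.scale/= mulr1.
Qed.

Lemma continuous_derive_exprS (k : nat) : continuous (fun x : R => k.+1%:R * x ^+ k).
Proof. by move=> x; apply: cvgM; [exact: cvg_cst|exact: exprn_continuous]. Qed.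

End real_derivatives.

(** * Polynomial growth and Gaussian integration by parts in one variable *)

Section gauss1d.
Context {R : realType}.
Implicit Types (g h : R -> R).
Local Notation leb := (@lebesgue_measure R).

(** Polynomial growth. The weight [1 + x ^+ 2] is at least 1, so exponents can be raised freely when
    bounds are combined, and it needs no absolute value. *)
Definition tempered g :=
  exists C : R, exists k : nat, forall x, `|g x| <= C * (1 + x ^+ 2) ^+ k.

Lemma ler1Dsqr (x : R) : 1 <= 1 + x ^+ 2.
Proof. by rewrite lerDl sqr_ge0. Qed.

Lemma ge0_1Dsqr (x : R) : 0 <= 1 + x ^+ 2.
Proof. exact: le_trans (ler1Dsqr x). Qed.

Lemma temperedP g : tempered g -> exists C : R, exists k : nat,
  0 <= C /\ forall x, `|g x| <= C * (1 + x ^+ 2) ^+ k.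
Proof.
move=> [C [k gC]]; exists `|C|, k; split => // x; apply: le_trans (gC x) _.
by rewrite ler_wpM2r ?ler_norm// exprn_ge0// ge0_1Dsqr.
Qed.

Lemma tempered_cst c : tempered (fun=> c).
Proof. by exists `|c|, 0%N => x; rewrite expr0 mulr1. Qed.

Lemma tempered_id : tempered id.
Proof.
exists 1, 1%N => x; rewrite expr1 mul1r; have := sqr_ge0 (`|x| - 1).
rewrite sqrrB1 real_normK ?num_real// mulr2n; have := sqr_ge0 x; lra.
Qed.

Lemma temperedM g h : tempered g -> tempered h -> tempered (fun x => g x * h x).
Proof.
move=> [C [k gC]] [D [l hD]]; exists (C * D), (k + l)%N => x.
by rewrite normrM exprD mulrACA ler_pM.
Qed.

Lemma temperedX g n : tempered g -> tempered (fun x => g x ^+ n).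
Proof.
move=> tg; elim: n => [|n IH]; first exact: tempered_cst.
by under eq_fun do rewrite exprS; exact: temperedM.
Qed.

Lemma temperedD g h : tempered g -> tempered h -> tempered (fun x => g x + h x).
Proof.
move=> /temperedP[C [k [C0 gC]]] /temperedP[D [l [D0 hD]]].
exists (C + D), (k + l)%N => x; rewrite (le_trans (ler_normD _ _))// mulrDl.
rewrite lerD//.
  apply: le_trans (gC x) _; rewrite exprD mulrA ler_peMr ?exprn_ege1 ?ler1Dsqr//.
  by rewrite mulr_ge0// exprn_ge0// ge0_1Dsqr.
apply: le_trans (hD x) _; rewrite exprD ler_wpM2l// ler_peMl//.
  by rewrite exprn_ge0// ge0_1Dsqr.
by rewrite exprn_ege1 ?ler1Dsqr.
Qed.

Lemma temperedN g : tempered g -> tempered (fun x => - g x).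
Proof. by move=> [C [k gC]]; exists C, k => x; rewrite normrN. Qed.

(** Since (a + x b)^2 <= 2 a^2 + 2 b^2 x^2, the weight at a + x b is at most (1 + 2 a^2 + 2 b^2) (1
    + x^2). This serves for a chaos seen as an affine function of one variable, the others being
    frozen. *)
Lemma tempered_affine g (a b : R) : tempered g -> tempered (fun x => g (a + x * b)).
Proof.
move=> /temperedP[C [k [C0 gC]]].
exists (C * (1 + 2 * a ^+ 2 + 2 * b ^+ 2) ^+ k), k => x.
apply: le_trans (gC _) _; rewrite -mulrA -exprMn ler_wpM2l//.
have a0 := sqr_ge0 a; have b0 := sqr_ge0 b; have x0 := sqr_ge0 x.
apply: lerXn2r; rewrite ?nnegrE ?ge0_1Dsqr//.
  by rewrite mulr_ge0 ?ge0_1Dsqr//; lra.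
have := sqr_ge0 (a - x * b); have := mulr_ge0 a0 x0.
have -> : (a - x * b) ^+ 2 = 2 * a ^+ 2 + 2 * x ^+ 2 * b ^+ 2 - (a + x * b) ^+ 2.
  by ring.
by move: a0 b0 x0; set u := (a + x * b) ^+ 2; nra.
Qed.

Section centered_normal.
Variables (s : R) (s_gt0 : 0 < s).
Local Notation pdf := (@normal_pdf R 0 s).
Let s_neq0 : s != 0. Proof. by rewrite gt_eqF. Qed.

Lemma normal_pdf0E x : pdf x = normal_peak s * expR (- x ^+ 2 / (s ^+ 2 *+ 2)).
Proof. by rewrite normal_pdfE// /normal_fun subr0. Qed.

(** With c = 4 s^2 (k + 1), 1 + y <= (1 + c) (1 + y / c) <= (1 + c) exp (y / c), and the power k + 1
    turns the exponent into y / (4 s^2). Taking k + 1 rather than k keeps c positive. *)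
Lemma expr1D_le_expR (k : nat) : exists2 M : R, 0 <= M &
  forall y : R, 0 <= y -> (1 + y) ^+ k <= M * expR (y / (4 * s ^+ 2)).
Proof.
pose c : R := 4 * s ^+ 2 * k.+1%:R.
have c0 : 0 < c by rewrite /c !mulr_gt0 ?exprn_gt0.
have cD1 : 0 <= 1 + c by rewrite addr_ge0// ltW.
exists ((1 + c) ^+ k.+1); first by rewrite exprn_ge0.
move=> y y0.
have yc0 : 0 <= y / c by rewrite divr_ge0// ltW.
have -> : y / (4 * s ^+ 2) = k.+1%:R * (y / c).
  by rewrite /c; field; rewrite nat1r pnatr_eq0 s_neq0.
rewrite expRM_natl -exprMn.
apply: (@le_trans _ _ ((1 + y) ^+ k.+1)).
  by rewrite exprS ler_peMl ?exprn_ge0 ?addr_ge0// lerDl.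
rewrite lerXn2r ?nnegrE ?mulr_ge0 ?addr_ge0 ?expR_ge0 ?(ltW c0)//.
apply: (@le_trans _ _ ((1 + c) * (1 + y / c))).
  have -> : (1 + c) * (1 + y / c) = 1 + y + c + y / c by field; rewrite gt_eqF.
  by rewrite -addrA lerDl addr_ge0// ltW.
by rewrite ler_wpM2l ?expR_ge1Dx.
Qed.

(** Half of the Gaussian exponent x^2 / (2 s^2) absorbs the polynomial; the other half remains. *)
Lemma tempered_pdf_le g : tempered g -> exists2 M : R, 0 <= M &
  forall x, `|g x * pdf x| <= M * expR (- x ^+ 2 / (4 * s ^+ 2)).
Proof.
move=> [C [k gC]]; have [M M0 HM] := expr1D_le_expR k.
exists (`|C| * M * normal_peak s); first by rewrite !mulr_ge0 ?normal_peak_ge0.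
move=> x; rewrite normrM (ger0_norm (normal_pdf_ge0 _ _ _)) normal_pdf0E.
rewrite mulrCA (_ : _ * _ * _ * _ =
  normal_peak s * (`|C| * M * expR (- x ^+ 2 / (4 * s ^+ 2)))); last by ring.
rewrite ler_wpM2l ?normal_peak_ge0//.
have -> : - x ^+ 2 / (4 * s ^+ 2) = x ^+ 2 / (4 * s ^+ 2) - x ^+ 2 / (s ^+ 2 *+ 2).
  by rewrite -mulr_natr; field.
rewrite expRD mulrA mulNr ler_wpM2r ?expR_ge0//.
rewrite (le_trans (gC x))//.
rewrite (@le_trans _ _ (`|C| * (1 + x ^+ 2) ^+ k))//.
  by rewrite ler_wpM2r ?ler_norm// exprn_ge0// addr_ge0// sqr_ge0.
by rewrite -mulrA ler_wpM2l// HM// sqr_ge0.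
Qed.

(** Up to a constant this is the normal density of standard deviation s sqrt 2. *)
Lemma integrable_expR_sqr :
  leb.-integrable setT (EFin \o (fun x : R => expR (- x ^+ 2 / (4 * s ^+ 2)))).
Proof.
have s0 : s * Num.sqrt 2 != 0 :> R by rewrite mulf_neq0// sqrtr_eq0 -ltNge.
rewrite (_ : _ \o _ = fun x => (normal_peak (s * Num.sqrt 2))^-1%:E *
    (normal_pdf 0 (s * Num.sqrt 2 : R) x)%:E)%E; last first.
  apply/funext => x /=; rewrite -EFinM normal_pdfE// mulKf; last first.
    by rewrite gt_eqF ?normal_peak_gt0.
  rewrite /normal_fun subr0 exprMn sqr_sqrtr//; congr ((expR (_ / _))%:E).
  by rewrite -mulr_natr; ring.
apply: integrableZl => //; exact: integrable_normal_pdf.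
Qed.

Lemma integrable_tempered_pdf g : measurable_fun setT g -> tempered g ->
  leb.-integrable setT (EFin \o (fun x => g x * pdf x)).
Proof.
move=> mg /tempered_pdf_le[M M0 gM].
have iM := integrableZl measurableT M integrable_expR_sqr.
apply: le_integrable iM => //.
  by apply/measurable_EFinP/measurable_funM => //; exact: measurable_normal_pdf.
move=> x _ /=; rewrite lee_fin (le_trans (gM x))//.
by rewrite ger0_norm// mulr_ge0 ?expR_ge0.
Qed.

(** The fundamental theorem of calculus on [-(n + 1), n + 1], then dominated convergence; the shift
    by 1 keeps the interval nondegenerate. *)
Lemma integral_derive_eq0 (W w : R -> R) :
  (forall x : R, is_derive x 1 W (w x)) -> continuous w ->
  leb.-integrable setT (EFin \o w) ->
  (fun n : nat => W n.+1%:R - W (- n.+1%:R)) @ \oo --> 0 ->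
  (\int[leb]_x (w x)%:E)%E = 0%E.
Proof.
move=> dW cw iw Wlim.
pose f_ (n : nat) x := ((w \_ `[- n.+1%:R, n.+1%:R]) x)%:E.
have mw : measurable_fun setT w by exact: continuous_measurable_fun.
have [| | | | |_ _] := @dominated_convergence _ _ R leb setT measurableT f_
  (EFin \o w) (fun x => `|w x|%:E).
- move=> n; apply/measurable_EFinP; rewrite /f_; apply/(measurable_restrictT _ _).1.
    exact: measurable_itv.
  exact: measurable_funTS.
- exact/measurable_EFinP.
- apply: aeW => x _; apply: cvg_near_cst.
  near=> n; rewrite /f_ patchE mem_set//= in_itv/= -ler_norml.
  by rewrite (@le_trans _ _ n%:R) ?ler_nat//; near: n; exact: nbhs_infty_ger.
- exact: integrable_norm.
- apply: aeW => x n _; rewrite lee_fin /f_ patchE; case: ifP => //.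
  by rewrite normr0.
move=> cvgI; apply: (cvg_unique _ cvgI) => //.
have -> : [sequence (\int[leb]_x f_ n x)%E]_n =
    (fun n : nat => (W n.+1%:R - W (- n.+1%:R))%:E).
  apply/funext => n /=.
  rewrite EFinB -(continuous_FTC2 (f := w)).
  - by rewrite [in RHS]integral_mkcond restrict_EFin.
  - by rewrite gtrN ?ltr0n.
  - exact: continuous_subspaceT.
  - have cW := is_derive_continuous dW.
    split => //; [exact/cvg_at_right_filter/cW|exact/cvg_at_left_filter/cW].
  - by move=> x _; rewrite derive1E derive_val.
by apply: cvg_EFin => //; exact: nearW.
Unshelve. all: by end_near.
Qed.

(** Both functions have the same integral over every measurable set. This lets integrals against
    [normal_prob] be computed as Lebesgue integrals with the explicit density. *)
Lemma normal_pdf0_ae_eq : ae_eq leb setT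
  (Radon_Nikodym_SigmaFinite.f (normal_prob 0 s) leb) (EFin \o pdf).
Proof.
have dom := @normal_prob_dominates R 0 s.
apply: integral_ae_eq => //.
- exact: Radon_Nikodym_SigmaFinite.f_integrable.
- by apply/measurable_EFinP; exact: measurable_normal_pdf.
- by move=> A _ mA; rewrite -Radon_Nikodym_SigmaFinite.f_integral.
Qed.

Lemma ge0_integral_normal (f : R -> \bar R) : measurable_fun setT f ->
  (forall x, 0 <= f x)%E ->
  (\int[normal_prob 0 s]_x f x = \int[leb]_x (f x * (pdf x)%:E))%E.
Proof.
move=> mf f0; have dom := @normal_prob_dominates R 0 s.
rewrite -(Radon_Nikodym_SigmaFinite.change_of_variables dom)//.
apply: ae_eq_integral => //.
- apply: emeasurable_funM => //.
  by apply: (measurable_int leb); exact: Radon_Nikodym_SigmaFinite.f_integrable.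
- by apply: emeasurable_funM => //; apply/measurable_EFinP; exact: measurable_normal_pdf.
- exact/ae_eqe_mul2l/normal_pdf0_ae_eq.
Qed.

Lemma integrable_normal g : measurable_fun setT g -> tempered g ->
  (normal_prob 0 s).-integrable setT (EFin \o g).
Proof.
move=> mg tg; apply/integrableP; split; first exact/measurable_EFinP.
rewrite ge0_integral_normal//; last first.
  by apply: measurableT_comp => //; exact/measurable_EFinP.
have /integrableP[_] := integrable_tempered_pdf mg tg.
congr (_ < _)%E; apply: eq_integral => x _ /=.
by rewrite -EFinM normrM (ger0_norm (normal_pdf_ge0 _ _ _)).
Qed.

Lemma integral_normal g : measurable_fun setT g -> tempered g ->
  (\int[normal_prob 0 s]_x (g x)%:E = \int[leb]_x (g x * pdf x)%:E)%E.
Proof.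
move=> mg tg; have ig := integrable_normal mg tg.
have dom := @normal_prob_dominates R 0 s.
rewrite integralE [RHS]integralE; congr (_ - _)%E.
- rewrite ge0_integral_normal//; last first.
    by apply: measurable_funepos; exact/measurable_EFinP.
  apply: eq_integral => x _; rewrite !funeposE /= -!EFin_max -EFinM.
  by rewrite maxr_pMl ?normal_pdf_ge0// mul0r.
- rewrite ge0_integral_normal//; last first.
    by apply: measurable_funeneg; exact/measurable_EFinP.
  apply: eq_integral => x _; rewrite !funenegE /= -!EFin_max -EFinM.
  by rewrite maxr_pMl ?normal_pdf_ge0// mul0r mulNr.
Qed.

Lemma is_derive_normal_pdf0 (x : R) : is_derive x 1 (pdf : R -> R) (- x / s ^+ 2 * pdf x).
Proof.
rewrite (_ : pdf = (fun x => normal_peak s * expR (- x ^+ 2 / (s ^+ 2 *+ 2))) :> (R -> R)); last first.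
  by apply/funext => y; rewrite normal_pdf0E.
have H : is_derive x 1 (fun x : R => - x ^+ 2 / (s ^+ 2 *+ 2)) (- x / s ^+ 2).
  by apply: is_derive_eq; rewrite /GRing.scale/= -mulr_natr; field.
have := @is_derive1_comp _ expR (fun x : R => - x ^+ 2 / (s ^+ 2 *+ 2)) x _ _ (is_derive_expR _) H.
move=> /(is_deriveZ (normal_peak s)) /is_derive_eq; apply.
by rewrite /GRing.scale/=; ring.
Qed.

(** From exp t >= 1 + t, exp (- y^2 / (4 s^2)) <= 4 s^2 / y^2 <= 4 s^2 / y for y >= 1. The factor
    [c] is 1 or -1, one value for each end of the line. *)
Lemma normal_pdf0_cvg0 g : tempered g -> forall c : R, `|c| = 1 ->
  (fun n : nat => g (c * n.+1%:R) * pdf (c * n.+1%:R)) @ \oo --> 0.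
Proof.
move=> tg c c1; have [M M0 hM] := tempered_pdf_le tg.
apply/norm_cvg0P.
apply: (@squeeze_cvgr _ _ _ _ (fun=> 0) (fun n => (4 * s ^+ 2 * M) * n.+1%:R^-1)).
- apply: nearW => n; rewrite normr_ge0/= (le_trans (hM _))//.
  rewrite (mulrC _ M) -mulrA ler_wpM2l// exprMn -(real_normK (num_real c)) c1 expr1n mul1r.
  set y := n.+1%:R; have y1 : 1 <= y by rewrite ler1n.
  have y0 : 0 < y by exact: lt_le_trans y1.
  have d0 : 0 < 4 * s ^+ 2 by rewrite mulr_gt0 ?exprn_gt0.
  rewrite mulNr expRN -lef_pV2 ?posrE ?invr_gt0 ?mulr_gt0 ?expR_gt0 ?invr_gt0//.
  rewrite invrK invfM invrK (le_trans _ (expR_ge1Dx _))//.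
  rewrite mulrC -[leLHS]add0r lerD// ler_wpM2r ?invr_ge0 ?(ltW d0)//.
  by rewrite expr2 ler_peMl// ltW.
- exact: cvg_cst.
- rewrite -[X in _ --> X](mulr0 (4 * s ^+ 2 * M)); apply: cvgM; first exact: cvg_cst.
  exact: cvg_harmonic.
Qed.

(** The difference of the two integrands, times the density, is the derivative of - s^2 h(x) pdf(x),
    which vanishes at both infinities. *)
Lemma normal_ibp (h h' : R -> R) : (forall x : R, is_derive x 1 h (h' x)) ->
  continuous h' -> tempered h -> tempered h' ->
  (\int[normal_prob 0 s]_x (x * h x)%:E = \int[normal_prob 0 s]_x (s ^+ 2 * h' x)%:E)%E.
Proof.
move=> dh ch' th th'.
have ch := is_derive_continuous dh.
have mh : measurable_fun setT h by exact: continuous_measurable_fun.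
have csh' : continuous (fun x : R => s ^+ 2 * h' x).
  by move=> x; apply: cvgM; [exact: cvg_cst|exact: ch'].
have mh' : measurable_fun setT (fun x : R => s ^+ 2 * h' x) by exact: continuous_measurable_fun.
have tsh : tempered (fun x : R => - (s ^+ 2 * h x)).
  by apply/temperedN/temperedM => //; exact: tempered_cst.
have tsh' : tempered (fun x : R => s ^+ 2 * h' x).
  by apply: temperedM => //; exact: tempered_cst.
have mxh : measurable_fun setT (fun x : R => x * h x) by exact: measurable_funM.
have txh : tempered (fun x : R => x * h x) by apply: temperedM => //; exact: tempered_id.
pose w x := (x * h x - s ^+ 2 * h' x) * pdf x.
have tw : tempered (fun x : R => x * h x - s ^+ 2 * h' x).
  by apply: temperedD => //; exact: temperedN.
have mw : measurable_fun setT (fun x : R => x * h x - s ^+ 2 * h' x) by exact: measurable_funB.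
have cw : continuous w.
  move=> x; apply: cvgM; last by apply: continuous_normal_pdf; exact: s_neq0.
  apply: cvgB; last exact: csh'.
  by apply: cvgM; [exact: cvg_id|exact: ch].
have iw : (\int[normal_prob 0 s]_x (x * h x - s ^+ 2 * h' x)%:E = 0)%E.
  rewrite integral_normal//.
  apply: (@integral_derive_eq0 (fun x => - (s ^+ 2 * h x) * pdf x)).
  - move=> x; rewrite /w.
    have := is_deriveM (is_deriveN (is_deriveZ (s ^+ 2) (dh x))) (is_derive_normal_pdf0 x).
    move=> /is_derive_eq; apply.
    by rewrite /GRing.scale/= fctE (_ : (s ^+ 2 \*: h) x = s ^+ 2 * h x)//; field.
  - exact: cw.
  - exact: integrable_tempered_pdf.
  - rewrite -[X in _ --> X](subrr 0); apply: cvgB.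
      have := normal_pdf0_cvg0 tsh (normr1 R).
      by under eq_cvg do rewrite mul1r.
    have := @normal_pdf0_cvg0 _ tsh (-1); rewrite normrN1 => /(_ erefl).
    by under eq_cvg do rewrite mulN1r.
move: iw; under eq_integral do rewrite EFinB.
rewrite integralB_EFin//; [|exact: integrable_normal..].
have fA : (\int[normal_prob 0 s]_x (x * h x)%:E)%E \is a fin_num.
  by apply: integrable_fin_num => //; exact: integrable_normal mxh txh.
have fB : (\int[normal_prob 0 s]_x (s ^+ 2 * h' x)%:E)%E \is a fin_num.
  by apply: integrable_fin_num => //; exact: integrable_normal mh' tsh'.
rewrite -(fineK fA) -(fineK fB) -EFinB => -[] /eqP.
by rewrite subr_eq0 => /eqP ->.
Qed.

End centered_normal.

End gauss1d.

(** * Mills' inequality and Stein's equation *)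

Section stein.
Context {R : realType}.
Local Notation leb := (@lebesgue_measure R).
Local Notation pdf := (@normal_pdf R 0 1).

Lemma std_pdf_gt0 (x : R) : 0 < pdf x.
Proof. by rewrite (normal_pdf0E ltr01) mulr_gt0 ?expR_gt0 ?normal_peak_gt0 ?oner_neq0. Qed.

Lemma continuous_std_pdf : continuous (pdf : R -> R).
Proof. by apply: continuous_normal_pdf; exact: oner_neq0. Qed.

(** On the half-line t >= x the left side is at most the integral of t pdf(t), whose antiderivative
    is - pdf. *)
Lemma mills_ratio (x : R) : 0 < x ->
  x * (\int[leb]_(t in `[x, +oo[) pdf t) <= pdf x.
Proof.
move=> x0.
have cp : continuous (fun t : R => t * pdf t).
  by move=> t; apply: cvgM; [exact: cvg_id|exact: continuous_std_pdf].
have mp := measurable_normal_pdf (0 : R) 1.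
have FTC : \int[leb]_(t in `[x, +oo[) (t * pdf t) = pdf x.
  rewrite (@Rintegral_ge0_continuous_FTC2y _ _ (fun t => - pdf t) _ 0).
  - by rewrite opprK add0r.
  - by move=> t xt; rewrite mulr_ge0 ?normal_pdf_ge0// (le_trans (ltW x0)).
  - exact: continuous_subspaceT.
  - rewrite -[X in _ --> X]oppr0; apply: cvgN.
    apply: (@squeeze_cvgr _ _ _ _ (fun=> 0)
      (fun t => normal_peak 1 * expR (1 / 2) * expR (- t))).
    (* As t^2 / 2 >= t - 1 / 2, the density is at most a multiple of exp (- t). *)
    - apply: nearW => t; rewrite normal_pdf_ge0/= (normal_pdf0E ltr01) -mulrA.
      rewrite ler_wpM2l ?normal_peak_ge0// -expRD ler_expR.
      by have := sqr_ge0 (t - 1); lra.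
    - exact: cvg_cst.
    - rewrite -[X in _ --> X](mulr0 (normal_peak 1 * expR (1 / 2))).
      by apply: cvgM; [exact: cvg_cst|exact: cvgr_expR].
  - by move=> t _; apply: derivableN; have [] := (is_derive_normal_pdf0 ltr01) t.
  - by apply: cvg_at_right_filter; apply: cvgN; exact: continuous_std_pdf.
  - move=> t _; rewrite derive1E deriveN.
      by have [_ ->] := (is_derive_normal_pdf0 ltr01) t; rewrite expr1n; field.
    by have [] := (is_derive_normal_pdf0 ltr01) t.
have ip := integrable_normal_pdf (0 : R) 1.
rewrite -FTC -RintegralZl//; last exact: integrableS ip.
apply: le_Rintegral => //.
- apply: (@integrableS _ _ _ leb setT) => //.
  by apply: (integrable_tempered_pdf ltr01) => //; exact: tempered_cst.
- apply: (@integrableS _ _ _ leb setT) => //; apply: (integrable_tempered_pdf ltr01) => //.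
  exact: tempered_id.
- by move=> t; rewrite /= in_itv/= andbT => xt; rewrite ler_wpM2r ?normal_pdf_ge0.
Qed.

Lemma Rintegral_std_pdf_sym (x : R) :
  \int[leb]_(t in `]-oo, (- x)]) pdf t = \int[leb]_(t in `[x, +oo[) pdf t.
Proof.
rewrite /Rintegral ge0_integration_by_substitutionNy.
- congr fine; apply: eq_integral => t _ /=; congr (_%:E).
  by rewrite !(normal_pdf0E ltr01) sqrrN.
- exact/continuous_subspaceT/continuous_std_pdf.
- by move=> t _; exact: normal_pdf_ge0.
Qed.


(** The solution is the integral of psi pdf over (-oo, x], divided by pdf(x). The quantity to bound
    is x g(x): then g' = x g + psi is at most 2 K, the constant of the final estimate. Mills'
    inequality gives this bound on each side of 0. *)
Lemma stein_solution (psi : R -> R) (K : R) : continuous psi ->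
  (forall x, `|psi x| <= K) ->
  (\int[normal_prob 0 1]_x (psi x)%:E = 0)%E ->
  exists g : R -> R, [/\ forall x : R, is_derive x 1 g (x * g x + psi x),
    forall x, `|x * g x| <= K & tempered g].
Proof.
move=> cpsi psiK Ipsi.
have K0 : 0 <= K := le_trans (normr_ge0 _) (psiK 0).
have mpsi : measurable_fun setT psi by exact: continuous_measurable_fun.
have tpsi : tempered psi.
  by exists K, 0%N => x; rewrite expr0 mulr1.
pose w x := psi x * pdf x.
have cw : continuous w.
  by move=> x; apply: cvgM; [exact: cpsi|exact: continuous_std_pdf].
have iw : leb.-integrable setT (EFin \o w) by exact: (integrable_tempered_pdf ltr01).
have iwS (D : set (measurableTypeR R)) : measurable D -> leb.-integrable D (EFin \o w).
  by move=> mD; apply: integrableS iw.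
pose G x := \int[leb]_(t in `]-oo, x]) w t.
have dG (x : R) : is_derive x 1 G (w x).
  have xx1 : x < x + 1 by rewrite ltrDl.
  have := @continuous_FTC1 R w (BInfty _ true) x _ xx1 (iwS _ (measurable_itv _)).
  move=> /= /(_ _ (cw x)) [|dGx <-]; first by rewrite ltNyr.
  by rewrite derive1E; exact: DeriveDef.
exists (fun x => G x * (pdf x)^-1).
have Gle (A : set (measurableTypeR R)) : measurable A ->
    `|\int[leb]_(t in A) w t| <= K * \int[leb]_(t in A) pdf t.
  move=> mA; have ip : leb.-integrable A (EFin \o pdf).
    by apply: integrableS (integrable_normal_pdf _ _).
  rewrite (le_trans (le_normr_Rintegral mA (iwS _ mA)))// -RintegralZl//.
  apply: le_Rintegral => //.
  - exact: integrable_norm (iwS _ mA).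
  - apply: (@integrableS _ _ _ leb setT) => //.
    by apply: (integrable_tempered_pdf ltr01) => //; exact: tempered_cst.
  - move=> t _; rewrite normrM (ger0_norm (normal_pdf_ge0 _ _ _)).
    by rewrite ler_wpM2r ?normal_pdf_ge0.
have xgK x : `|x * (G x * (pdf x)^-1)| <= K.
  rewrite !normrM normfV (ger0_norm (normal_pdf_ge0 _ _ _)) mulrA.
  rewrite ler_pdivrMr ?std_pdf_gt0//.
  have [x0|x0|->] := ltgtP x 0; last first.
  - by rewrite normr0 mul0r mulr_ge0// normal_pdf_ge0.
  - rewrite (ger0_norm (ltW x0)).
    (* As psi has mean 0, for x > 0 the integral up to x is minus the integral beyond x, a tail to
       which Mills' inequality applies. *)
    have Gx : `|G x| <= K * \int[leb]_(t in `[x, +oo[) pdf t.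
      have I0 : \int[leb]_t w t = 0.
        by rewrite /Rintegral -(integral_normal ltr01)// Ipsi.
      have := @Rintegral_itvB _ w (BInfty _ true) (BInfty _ false) x.
      rewrite set_itvNyy => /(_ (iwS _ measurableT)); rewrite !bnd_simp => /(_ erefl erefl).
      rewrite I0 sub0r => /eqP; rewrite eqr_oppLR => /eqP; rewrite -/(G x) => ->.
      rewrite normrN Rintegral_itv_obnd_cbnd; last exact: iwS.
      exact: Gle.
    apply: (@le_trans _ _ (x * (K * \int[leb]_(t in `[x, +oo[) pdf t))).
      by rewrite ler_wpM2l// ltW.
    by rewrite mulrCA ler_wpM2l// mills_ratio.
  - have Nx0 : 0 < - x by rewrite oppr_gt0.
    rewrite (ltr0_norm x0) (@le_trans _ _ (- x * (K * \int[leb]_(t in `]-oo, x]) pdf t)))//.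
      by rewrite ler_wpM2l ?(ltW Nx0)// Gle.
    rewrite mulrCA ler_wpM2l// -[X in `]-oo, X]](opprK x) Rintegral_std_pdf_sym.
    rewrite (le_trans (mills_ratio Nx0))// !(normal_pdf0E ltr01) sqrrN//.
split => //.
- move=> x.
  have := is_deriveM (dG x) (is_deriveV (lt0r_neq0 (std_pdf_gt0 x)) ((is_derive_normal_pdf0 ltr01) x)).
  move=> /is_derive_eq; apply.
  rewrite /GRing.scale/= /w. field. exact: lt0r_neq0 (std_pdf_gt0 x).
(* For |x| >= 1 the bound on x g(x) bounds g by K; for |x| < 1 the density is at least [pdf 1] and
   the numerator is at most K. *)
- exists (K + K / pdf 1), 0%N => x; rewrite expr0 mulr1.
  have [x1|x1] := leP 1 `|x|.
    apply: (@le_trans _ _ (`|x * (G x * (pdf x)^-1)|)).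
      by rewrite [leRHS]normrM ler_peMl.
    by rewrite (le_trans (xgK x))// lerDl divr_ge0 ?normal_pdf_ge0.
  rewrite normrM normfV (ger0_norm (normal_pdf_ge0 _ _ x)).
  apply: (@le_trans _ _ (K / pdf 1)); last by rewrite lerDr.
  apply: ler_pM => //; first by rewrite invr_ge0 normal_pdf_ge0.
  - rewrite (le_trans (Gle _ _))// ler_piMr//.
    have I1 : \int[leb]_t pdf t = 1 by rewrite /Rintegral integral_normal_pdf.
    rewrite -[leRHS]I1 -lee_fin /Rintegral !fineK; last 2 first.
    - apply: integrable_fin_num => //; exact: integrable_normal_pdf.
    - apply: integrable_fin_num => //.
      by apply: integrableS (integrable_normal_pdf _ _).
    apply: ge0_subset_integral => //.
      by apply/measurable_EFinP; exact: measurable_normal_pdf.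
    by move=> t _; rewrite lee_fin normal_pdf_ge0.
  - rewrite lef_pV2 ?posrE ?std_pdf_gt0// !(normal_pdf0E ltr01) ler_wpM2l ?normal_peak_ge0//.
    rewrite ler_expR ler_pM2r ?invr_gt0 ?mulrn_wgt0 ?exprn_gt0// lerN2 expr1n -(real_normK (num_real x)).
    by rewrite expr_le1// ltW.
Qed.
End stein.

(** * Real-valued expectations of integrable functions *)

Section integrable_real.
Context d (Omega : measurableType d) (R : realType) (P : probability Omega R).
Implicit Types f g h : Omega -> R.

Definition intg f := P.-integrable setT (EFin \o f).

Lemma intgD f g : intg f -> intg g -> intg (fun w => f w + g w).
Proof.
move=> fi gi; rewrite /intg (_ : _ \o _ = (EFin \o f) \+ (EFin \o g))%E//.
exact: integrableD.
Qed.

Lemma intgZ c f : intg f -> intg (fun w => c * f w).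
Proof.
move=> fi; rewrite /intg (_ : _ \o _ = fun w => c%:E * (EFin \o f) w)%E//.
exact: integrableZl.
Qed.

Lemma intgB f g : intg f -> intg g -> intg (fun w => f w - g w).
Proof.
move=> fi gi; rewrite /intg (_ : _ \o _ = (EFin \o f) \- (EFin \o g))%E//.
exact: integrableB.
Qed.

Lemma intg_cst c : intg (fun=> c).
Proof. exact: finite_measure_integrable_cst. Qed.

Lemma intg_le f g : measurable_fun setT f -> (forall w, `|f w| <= g w) -> intg g -> intg f.
Proof.
move=> mf fg gi; apply: le_integrable gi => //; first exact/measurable_EFinP.
by move=> w _; rewrite /= lee_fin (le_trans (fg w))// ler_norm.
Qed.

Definition Ex f : R := \int[P]_w f w.

Lemma EintE f : intg f -> (\int[P]_w (f w)%:E)%E = (Ex f)%:E.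
Proof. by move=> fi; rewrite /Ex /Rintegral fineK//; exact: integrable_fin_num. Qed.

Lemma EintD f g : intg f -> intg g -> Ex (fun w => f w + g w) = Ex f + Ex g.
Proof. by move=> fi gi; rewrite /Ex RintegralD. Qed.

Lemma EintB f g : intg f -> intg g -> Ex (fun w => f w - g w) = Ex f - Ex g.
Proof. by move=> fi gi; rewrite /Ex RintegralB. Qed.

Lemma EintZ c f : intg f -> Ex (fun w => c * f w) = c * Ex f.
Proof. by move=> fi; rewrite /Ex RintegralZl. Qed.

Lemma Eint_le f g : intg f -> intg g -> (forall w, f w <= g w) -> Ex f <= Ex g.
Proof. by move=> fi gi fg; exact: le_Rintegral. Qed.

Lemma Eint_dist f g h : intg f -> intg g -> intg h ->
  (forall w, `|f w - g w| <= h w) -> `|Ex f - Ex g| <= Ex h.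
Proof.
move=> fi gi hi fgh; rewrite -EintB//; have fgi := intgB fi gi.
rewrite (le_trans (le_normr_Rintegral measurableT fgi))//.
by apply: le_Rintegral => //; exact: integrable_norm fgi.
Qed.

Lemma Ex_cst c : Ex (fun=> c) = c.
Proof. by rewrite /Ex Rintegral_cst// [X in fine X](@probability_setT _ _ _ P) mulr1. Qed.

Lemma Ex_ge0 f : (forall w, 0 <= f w) -> 0 <= Ex f.
Proof. by move=> f0; exact: Rintegral_ge0. Qed.

Lemma eq_Ex f g : f =1 g -> Ex f = Ex g.
Proof. by move=> fg; congr Ex; exact/funext. Qed.

End integrable_real.

(** * Random variables with moments of all orders *)

Section moments.
Context d (Omega : measurableType d) (R : realType) (P : probability Omega R).
Implicit Types (Y Z W : Omega -> R).

(** The powers of [1 + Y ^+ 2] dominate every tempered function of [Y] directly and are nonnegative,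
    so that no absolute moments occur. *)
Definition all_moments Y := measurable_fun setT Y /\
  forall k : nat, P.-integrable setT (EFin \o (fun w => (1 + Y w ^+ 2) ^+ k)).

Lemma all_moments_tempered_int Y (g : R -> R) : all_moments Y ->
  measurable_fun setT g -> tempered g -> P.-integrable setT (EFin \o (g \o Y)).
Proof.
move=> [mY iY] mg [C [k gC]].
have iCY : P.-integrable setT (EFin \o (fun w => C * (1 + Y w ^+ 2) ^+ k)).
  rewrite (_ : _ \o _ = fun w => C%:E * ((1 + Y w ^+ 2) ^+ k)%:E)%E//.
  by apply: integrableZl => //; exact: iY.
apply: le_integrable iCY => //.
  by apply/measurable_EFinP; exact: measurableT_comp.
by move=> w _; rewrite lee_fin (le_trans (gC _))// ler_norm.
Qed.

Lemma all_moments_integrable Y : all_moments Y -> P.-integrable setT (EFin \o Y).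
Proof.
move=> aY; apply: (all_moments_tempered_int aY (g := id)) => //.
exact: tempered_id.
Qed.

(** Reduces closure under sums, products and composition to one pointwise inequality. [Y] and [Z]
    may be dependent: the product of their weights is split by u v <= u^2 + v^2, whence the doubled
    exponents in [D]. *)
Lemma all_moments_dom Y Z W (c : R) (n : nat) : all_moments Y -> all_moments Z ->
  measurable_fun setT W ->
  (forall w, 1 + W w ^+ 2 <= c * ((1 + Y w ^+ 2) * (1 + Z w ^+ 2)) ^+ n) ->
  all_moments W.
Proof.
move=> [mY iY] [mZ iZ] mW Wle; split=> // k.
pose D w := c ^+ k * ((1 + Y w ^+ 2) ^+ (n * k * 2) + (1 + Z w ^+ 2) ^+ (n * k * 2)).
have iD : P.-integrable setT (EFin \o D).
  rewrite (_ : _ \o _ = fun w => (c ^+ k)%:E * ((EFin \o (fun w => (1 + Y w ^+ 2) ^+ (n * k * 2))%R) \+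
     (EFin \o (fun w => (1 + Z w ^+ 2) ^+ (n * k * 2))%R)) w)%E//.
  by apply: integrableZl => //; exact: integrableD.
apply: le_integrable iD => //.
  apply/measurable_EFinP; apply: measurable_funX; apply: measurable_funD => //.
  exact: measurable_funX.
move=> w _; rewrite /= lee_fin ger0_norm ?exprn_ge0 ?ge0_1Dsqr//.
apply: le_trans (ler_norm _); rewrite /D.
have Y1 := ge0_1Dsqr (Y w); have Z1 := ge0_1Dsqr (Z w).
have W1 := ge0_1Dsqr (W w).
have c0 : 0 <= c.
  have := le_trans W1 (Wle w); have W1' := lt_le_trans ltr01 (le_trans (ler1Dsqr _) (Wle w)).
  by rewrite pmulr_lge0// exprn_gt0// mulr_gt0// (lt_le_trans ltr01 (ler1Dsqr _)).
apply: le_trans (lerXn2r k _ _ (Wle w)) _; rewrite ?nnegrE//.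
  by rewrite mulr_ge0// exprn_ge0// mulr_ge0.
rewrite exprMn -exprM ler_wpM2l ?exprn_ge0// exprMn !(exprM _ (n * k)).
set y := _ ^+ _; set z := _ ^+ (n * k); have := sqr_ge0 (y - z).
have : 0 <= y by exact: exprn_ge0.
have : 0 <= z by exact: exprn_ge0.
nra.
Qed.

Lemma all_moments_cst c : all_moments (fun=> c).
Proof.
split=> // k; exact: finite_measure_integrable_cst.
Qed.

Lemma all_momentsD Y Z : all_moments Y -> all_moments Z ->
  all_moments (fun w => Y w + Z w).
Proof.
move=> aY aZ; apply: (@all_moments_dom Y Z _ 2 1) => //.
  by apply: measurable_funD; [case: aY|case: aZ].
move=> w; rewrite expr1; have := sqr_ge0 (Y w - Z w).
have := mulr_ge0 (sqr_ge0 (Y w)) (sqr_ge0 (Z w)); nra.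
Qed.

Lemma all_momentsM Y Z : all_moments Y -> all_moments Z ->
  all_moments (fun w => Y w * Z w).
Proof.
move=> aY aZ; apply: (@all_moments_dom Y Z _ 1 1) => //.
  by apply: measurable_funM; [case: aY|case: aZ].
move=> w; rewrite expr1 mul1r; have := sqr_ge0 (Y w); have := sqr_ge0 (Z w); nra.
Qed.

Lemma all_momentsZ c Y : all_moments Y -> all_moments (fun w => c * Y w).
Proof. by move=> aY; apply: all_momentsM => //; exact: all_moments_cst. Qed.

Lemma all_momentsN Y : all_moments Y -> all_moments (fun w => - Y w).
Proof.
by move=> aY; under eq_fun do rewrite -mulN1r; exact: all_momentsZ.
Qed.

Lemma all_momentsB Y Z : all_moments Y -> all_moments Z ->
  all_moments (fun w => Y w - Z w).
Proof. by move=> aY aZ; apply: all_momentsD => //; exact: all_momentsN. Qed.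

Lemma all_momentsX Y n : all_moments Y -> all_moments (fun w => Y w ^+ n).
Proof.
move=> aY; elim: n => [|n IH]; first exact: all_moments_cst.
by under eq_fun do rewrite exprS; exact: all_momentsM.
Qed.

Lemma all_moments_sum (I : Type) (r : seq I) (p : pred I) (Y : I -> Omega -> R) :
  (forall i, p i -> all_moments (Y i)) ->
  all_moments (fun w => \sum_(i <- r | p i) Y i w).
Proof.
move=> aY; elim: r => [|i r IH].
  by rewrite (_ : (fun w => _) = fun=> 0); [exact: all_moments_cst|apply/funext => w; rewrite big_nil].
rewrite (_ : (fun w => _) = fun w => if p i then Y i w + \sum_(j <- r | p j) Y j w
  else \sum_(j <- r | p j) Y j w); last by apply/funext => w; rewrite big_cons.
by case: (boolP (p i)) => // pi; apply: all_momentsD => //; exact: aY.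
Qed.

Lemma all_moments_prod (I : Type) (r : seq I) (p : pred I) (Y : I -> Omega -> R) :
  (forall i, p i -> all_moments (Y i)) ->
  all_moments (fun w => \prod_(i <- r | p i) Y i w).
Proof.
move=> aY; elim: r => [|i r IH].
  by rewrite (_ : (fun w => _) = fun=> 1); [exact: all_moments_cst|apply/funext => w; rewrite big_nil].
rewrite (_ : (fun w => _) = fun w => if p i then Y i w * \prod_(j <- r | p j) Y j w
  else \prod_(j <- r | p j) Y j w); last by apply/funext => w; rewrite big_cons.
by case: (boolP (p i)) => // pi; apply: all_momentsM => //; exact: aY.
Qed.

Lemma all_moments_comp Y (g : R -> R) : all_moments Y ->
  measurable_fun setT g -> tempered g -> all_moments (g \o Y).
Proof.
move=> aY mg /temperedP[C [k [C0 gC]]].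
apply: (@all_moments_dom Y (fun=> 0) _ (1 + C ^+ 2) (k * 2)) => //.
- exact: all_moments_cst.
- by apply: measurableT_comp => //; case: aY.
move=> w; rewrite expr0n/= addr0 mulr1 mulrDl mul1r lerD//.
  by rewrite exprn_ege1// ler1Dsqr.
rewrite exprM -exprMn -(real_normK (num_real (g _))).
by rewrite lerXn2r ?nnegrE ?mulr_ge0 ?exprn_ge0 ?ge0_1Dsqr.
Qed.

Lemma am_intg Y : all_moments Y -> intg P Y.
Proof. exact: all_moments_integrable. Qed.

Lemma ExE Y : all_moments Y -> (\int[P]_w (Y w)%:E)%E = (Ex P Y)%:E.
Proof. by move=> aY; exact/EintE/am_intg. Qed.

Lemma ExD Y Z : all_moments Y -> all_moments Z ->
  Ex P (fun w => Y w + Z w) = Ex P Y + Ex P Z.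
Proof. by move=> aY aZ; apply: EintD; exact: am_intg. Qed.

Lemma ExB Y Z : all_moments Y -> all_moments Z ->
  Ex P (fun w => Y w - Z w) = Ex P Y - Ex P Z.
Proof. by move=> aY aZ; apply: EintB; exact: am_intg. Qed.

Lemma ExZ c Y : all_moments Y -> Ex P (fun w => c * Y w) = c * Ex P Y.
Proof. by move=> aY; apply: EintZ; exact: am_intg. Qed.

Lemma Ex_sum (I : Type) (r : seq I) (p : pred I) (Y : I -> Omega -> R) :
  (forall i, p i -> all_moments (Y i)) ->
  Ex P (fun w => \sum_(i <- r | p i) Y i w) = \sum_(i <- r | p i) Ex P (Y i).
Proof.
move=> aY; elim: r => [|i r IH].
  rewrite big_nil -[RHS](Ex_cst P 0); apply: eq_Rintegral => w _.
  by rewrite big_nil.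
rewrite big_cons (_ : (fun w => _) = fun w => if p i then Y i w + \sum_(j <- r | p j) Y j w
  else \sum_(j <- r | p j) Y j w); last by apply/funext => w; rewrite big_cons.
case: (boolP (p i)) => // pi; rewrite -IH -ExD//; first exact: aY.
exact: all_moments_sum.
Qed.

Lemma Ex_le Y Z : all_moments Y -> all_moments Z -> (forall w, Y w <= Z w) ->
  Ex P Y <= Ex P Z.
Proof. by move=> aY aZ; apply: Eint_le; exact: am_intg. Qed.

End moments.

(** * Uniqueness of measures on tuples *)

Section tuple_measure.
Context d (T : measurableType d) (R : realType) (n : nat).

Definition tuple_boxes : set (set (n.-tuple T)) :=
  [set B | exists2 A : 'I_n -> set T, (forall j, measurable (A j)) &
    B = [set t | forall j, A j (tnth t j)]].

Lemma measurable_tuple_box (A : 'I_n -> set T) : (forall j, measurable (A j)) ->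
  measurable [set t : n.-tuple T | forall j, A j (tnth t j)].
Proof.
move=> mA; rewrite [X in measurable X](_ : _ = \bigcap_(i in [set: 'I_n])
    ((fun t : n.-tuple T => tnth t i) @^-1` A i)).
  apply: fin_bigcap_measurable => // i _.
  by rewrite -[X in measurable X]setTI; exact: measurable_tnth.
by apply/seteqP; split => [t At i _|t At i]; exact: At.
Qed.

Lemma measurable_tupleE : @measurable _ (n.-tuple T) = <<s tuple_boxes >>.
Proof.
apply/seteqP; split.
  apply: smallest_sub; first exact: smallest_sigma_algebra.
  move=> B; rewrite -bigcup_seq => -[/= i _ [C mC <-]]; apply: sub_sigma_algebra.
  exists (fun j => if j == i then C else setT).
    by move=> j; case: ifP.
  rewrite setTI; apply/seteqP; split => [t Ct j|t /(_ i)]; last by rewrite eqxx.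
  by case: eqP => // ->.
apply: smallest_sub; first exact: sigma_algebra_measurable.
by move=> _ [A mA ->]; exact: measurable_tuple_box.
Qed.

(** Boxes are stable under intersection and generate the product sigma-algebra. *)
Lemma tuple_measure_unique (m1 m2 : {measure set (n.-tuple T) -> \bar R}) :
  (m1 setT < +oo)%E ->
  (forall A, tuple_boxes A -> m1 A = m2 A) ->
  forall A, measurable A -> m1 A = m2 A.
Proof.
move=> m1T m12; apply: (measure_unique tuple_boxes (fun=> setT)) => //.
- exact: measurable_tupleE.
- move=> _ _ [A mA ->] [B mB ->]; exists (fun j => A j `&` B j).
    by move=> j; exact: measurableI.
  apply/seteqP; split => [t [At Bt] j|t AB].
    by split; [exact: At|exact: Bt].
  by split => j; have [] := AB j.
- by move=> _; exists (fun=> setT) => //; apply/seteqP; split.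
- by rewrite bigcup_const.
Qed.

End tuple_measure.

(** * Independent Gaussians: freezing all coordinates but one *)

Section gaussian_family.
Context d (Omega : measurableType d) (R : realType) (P : probability Omega R).
Variables (n : nat) (X : 'I_n -> {RV P >-> R}) (s : 'I_n -> R).
Hypothesis s_gt0 : forall i, 0 < s i.
Hypothesis X_indep : mutually_independent X.
Hypothesis X_law : forall i (A : set R), measurable A ->
  distribution P (X i) A = normal_prob 0 (s i) A.

(* The i-th coordinate is set to 0 rather than dropped, which avoids any
   reindexing; in [mutually_independent] it corresponds to [A i] being [setT] or
   [set0]. *)
Definition rest (i : 'I_n) (w : Omega) : n.-tuple R :=
  [tuple if j == i then 0 else X j w | j < n].

Lemma measurable_rest i : measurable_fun setT (rest i).
Proof.
apply/measurable_fun_tnthP => j.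
rewrite (_ : _ \o _ = if j == i then cst 0 else X j); first by case: ifP.
by apply/funext => w /=; rewrite tnth_mktuple; case: ifP.
Qed.

HB.instance Definition _ i := isMeasurableFun.Build _ _ _ _ (rest i) (measurable_rest i).

(** For fixed [A] both sides are finite measures in [B]: the image under [rest i] of P restricted to
    the event X_i in A, and the law of [rest i] scaled by the probability of that event. They agree
    on boxes by mutual independence. *)
Lemma indep_rest i (A : set R) (B : set (n.-tuple R)) :
  measurable A -> measurable B ->
  P ((X i @^-1` A) `&` (rest i @^-1` B)) = (P (X i @^-1` A) * P (rest i @^-1` B))%E.
Proof.
move=> mA mB.
have mXA : measurable (X i @^-1` A).
  by rewrite -[X in measurable X]setTI; exact: measurable_funP.
pose m1 := [the {measure set _ -> \bar R} of pushforward (mrestr P mXA) (rest i)].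
have PX0 : 0 <= fine (P (X i @^-1` A)) by rewrite fine_ge0.
pose m2 := [the {measure set _ -> \bar R} of
  mscale (NngNum PX0) [the {measure set _ -> \bar R} of distribution P [the {mfun _ >-> _} of rest i]]].
have PXE : (fine (P (X i @^-1` A)))%:E = P (X i @^-1` A).
  by rewrite fineK// fin_num_measure.
have mZ := measurable_rest i.
have : m1 mZ B = m2 B.
  apply: (@tuple_measure_unique _ _ R n (m1 mZ) m2) => //.
    rewrite /m1 /= /pushforward /mrestr preimage_setT setTI.
    by rewrite -ge0_fin_numE// fin_num_measure.
  move=> _ [C mC ->]; rewrite /m1 /m2 /= /mscale /= /pushforward /mrestr /=.
  rewrite /distribution /pushforward PXE.
  (* Coordinate i of [rest i] is always 0, so the side [C i] of the box is met surely or never; [E]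
     carries the constraint on X_i itself. *)
  pose D j := if j == i then (if (0 : R) \in C i then setT else set0) else C j.
  pose E j := if j == i then A else setT : set R.
  have mD j : measurable (D j).
    by rewrite /D; case: ifP => _; [case: ifP|exact: mC].
  have mE j : measurable (E j) by rewrite /E; case: ifP.
  have restE : rest i @^-1` [set t | forall j, C j (tnth t j)] =
      \bigcap_(j in [set: 'I_n]) (X j @^-1` D j).
    apply/seteqP; split => [w Cw j _|w Dw j].
      have := Cw j; rewrite tnth_mktuple /D /=; case: eqP => // -> C0.
      by rewrite mem_set.
    rewrite tnth_mktuple; have := Dw j I; rewrite /D /=; case: eqP => // ->.
    by case: ifPn => // /set_mem.
  have -> : rest i @^-1` [set t | forall j, C j (tnth t j)] `&` X i @^-1` A =
      \bigcap_(j in [set: 'I_n]) (X j @^-1` (D j `&` E j)).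
    rewrite restE; apply/seteqP; split => [w [Dw Aw] j _|w DEw].
      by split; [exact: Dw|rewrite /E /=; case: eqP => // ->].
    split => [j _|]; first by have [] := DEw j I.
    by have [_] := DEw i I; rewrite /E eqxx.
  rewrite restE (X_indep mD) (X_indep (fun j => measurableI _ _ (mD j) (mE j))).
  rewrite (bigD1 i)//= [in RHS](bigD1 i)//= muleA; congr (_ * _)%E.
    rewrite /D /E eqxx; case: ifP => _.
      by rewrite setTI preimage_setT probability_setT mule1.
    by rewrite set0I preimage_set0 measure0 mule0.
  by apply: eq_bigr => j /negbTE ji; rewrite /E ji setIT.
rewrite /m1 /m2 /= /mscale /= /pushforward /mrestr /= PXE => <-.
by rewrite setIC.
Qed.

Lemma joint_law i (C : set (R * n.-tuple R)) : measurable C ->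
  (distribution P (X i) \x distribution P [the {mfun _ >-> _} of rest i])%E C =
  P ((fun w => (X i w, rest i w)) @^-1` C).
Proof.
move=> mC.
have mXZ : measurable_fun setT (fun w => (X i w, rest i w)).
  by apply/measurable_fun_pair => //; exact: measurable_rest.
pose m' := [the {measure set _ -> \bar R} of pushforward P (fun w => (X i w, rest i w))].
rewrite (@product_measure_unique _ _ _ _ R (distribution P (X i))
  (distribution P [the {mfun _ >-> _} of rest i]) (m' mXZ))// => A B mA mB.
exact: indep_rest.
Qed.

(** The joint law is a product by [joint_law]. The inner integral is over X_i with the other
    coordinates frozen, the form in which one-dimensional integration by parts applies. *)
Lemma independence_Fubini i (h : R * n.-tuple R -> R) : measurable_fun setT h ->
  P.-integrable setT (fun w => (h (X i w, rest i w))%:E) ->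
  (\int[P]_w (h (X i w, rest i w))%:E =
   \int[distribution P [the {mfun _ >-> _} of rest i]]_z
     \int[distribution P (X i)]_x (h (x, z))%:E)%E.
Proof.
move=> mh ih.
have mXZ : measurable_fun setT (fun w => (X i w, rest i w)).
  by apply/measurable_fun_pair => //; exact: measurable_rest.
pose m' := [the {measure set _ -> \bar R} of pushforward P (fun w => (X i w, rest i w))].
pose Z := [the {mfun _ >-> _} of rest i].
have mhE : measurable_fun setT (EFin \o h) by exact/measurable_EFinP.
have E1 : (\int[P]_w (h (X i w, rest i w))%:E = \int[m' mXZ]_z (h z)%:E)%E.
  by rewrite integral_pushforward.
have E2 : (\int[m' mXZ]_z (h z)%:E =
    \int[(distribution P (X i) \x distribution P Z)%E]_z (h z)%:E)%E.
  by apply: eq_measure_integral => C mC _; first [exact: joint_law | exact/esym/joint_law].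
rewrite E1 E2; symmetry; apply: integral21_prod_meas1.
apply/integrableP; split => //.
rewrite (eq_measure_integral (m' mXZ)); last first.
  by move=> C mC _; first [exact: joint_law | exact/esym/joint_law].
rewrite ge0_integral_pushforward//; last exact: measurableT_comp.
by have /integrableP[] := ih.
Qed.

Lemma integral_law i (f : R -> R) : measurable_fun setT f -> tempered f ->
  (\int[distribution P (X i)]_x (f x)%:E = \int[normal_prob 0 (s i)]_x (f x)%:E)%E
  /\ P.-integrable setT (EFin \o (f \o X i)).
Proof.
move=> mf tf.
have mX : measurable_fun setT (X i : Omega -> measurableTypeR R).
  have mX : measurable_fun setT (X i) by [].
  by move=> mD C mC; exact: (mX mD C mC).
pose m' := [the {measure set (measurableTypeR R) -> \bar R} of
   pushforward P (X i : Omega -> measurableTypeR R)].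
have mfE : measurable_fun setT (EFin \o f : measurableTypeR R -> _) by exact/measurable_EFinP.
have iN := integrable_normal (s_gt0 i) mf tf.
have iX : P.-integrable setT (EFin \o (f \o X i)).
  apply/integrableP; split; first by apply/measurable_EFinP; exact: measurableT_comp.
  have /integrableP[_] := iN.
  rewrite (eq_measure_integral (m' mX)); last by move=> C mC _; apply/esym; exact: (X_law i mC).
  by rewrite ge0_integral_pushforward//; exact: measurableT_comp.
split=> //.
rewrite integral_distribution//.
rewrite (eq_measure_integral (m' mX)); last by move=> C mC _; apply/esym; exact: (X_law i mC).
by rewrite integral_pushforward.
Qed.

Definition rest_fun (i : 'I_n) (U : Omega -> R) :=
  exists2 v : n.-tuple R -> R, measurable_fun setT v & U = v \o rest i.

Lemma rest_fun_cst i c : rest_fun i (fun=> c).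
Proof. by exists (fun=> c). Qed.

Lemma rest_fun_coord i j : j != i -> rest_fun i (X j).
Proof.
move=> /negbTE ji; exists (fun t => tnth t j); first exact: measurable_tnth.
by apply/funext => w /=; rewrite tnth_mktuple ji.
Qed.

Lemma rest_funD i U V : rest_fun i U -> rest_fun i V ->
  rest_fun i (fun w => U w + V w).
Proof.
move=> [u mu ->] [v mv ->]; exists (fun t => u t + v t) => //.
exact: measurable_funD.
Qed.

Lemma rest_funM i U V : rest_fun i U -> rest_fun i V ->
  rest_fun i (fun w => U w * V w).
Proof.
move=> [u mu ->] [v mv ->]; exists (fun t => u t * v t) => //.
exact: measurable_funM.
Qed.

Definition std_coord i (w : Omega) : R := (s i)^-1 * X i w.

Lemma all_moments_std_coord i : all_moments P (std_coord i).
Proof.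
apply: all_momentsZ; split=> // k.
have tf : tempered (fun x : R => (1 + x ^+ 2) ^+ k).
  by exists 1, k => x; rewrite mul1r ger0_norm// exprn_ge0// ge0_1Dsqr.
apply: (integral_law i _ tf).2.
by apply: measurable_funX; apply: measurable_funD => //; exact: measurable_funX.
Qed.

(** Once the other coordinates are frozen, the argument of g is affine in X_i and [normal_ibp]
    applies under the outer integral. *)
Lemma gaussian_ibp i (u A B : Omega -> R) (g g' : R -> R) :
  rest_fun i u -> rest_fun i A -> rest_fun i B ->
  all_moments P u -> all_moments P A -> all_moments P B ->
  (forall x : R, is_derive x 1 g (g' x)) -> continuous g' ->
  tempered g -> tempered g' ->
  Ex P (fun w => std_coord i w * (u w * g (A w + std_coord i w * B w))) =
  Ex P (fun w => u w * B w * g' (A w + std_coord i w * B w)).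
Proof.
move=> [u' mu ->] [A' mA ->] [B' mB ->] au aA aB dg cg' tg tg'.
have aX := all_moments_std_coord i.
have mg := continuous_measurable_fun (is_derive_continuous dg).
have mg' : measurable_fun setT g' by exact: continuous_measurable_fun.
have aF : all_moments P (fun w => (A' \o rest i) w + std_coord i w * (B' \o rest i) w).
  by apply: all_momentsD => //; exact: all_momentsM.
have agF := all_moments_comp aF mg tg; have ag'F := all_moments_comp aF mg' tg'.
have si0 : s i != 0 by rewrite gt_eqF.
pose L (z : R * n.-tuple R) := (s i)^-1 * z.1 * (u' z.2 * g (A' z.2 + (s i)^-1 * z.1 * B' z.2)).
pose Rh (z : R * n.-tuple R) := u' z.2 * B' z.2 * g' (A' z.2 + (s i)^-1 * z.1 * B' z.2).
have m2 (v : n.-tuple R -> R) : measurable_fun setT v ->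
    measurable_fun setT (fun z : R * n.-tuple R => v z.2).
  by move=> mv; exact: (measurableT_comp mv measurable_snd).
have m1 : measurable_fun setT (fun z : R * n.-tuple R => (s i)^-1 * z.1).
  by apply: measurable_funM => //; exact: measurable_fst.
have mAB : measurable_fun setT (fun z : R * n.-tuple R => A' z.2 + (s i)^-1 * z.1 * B' z.2).
  by apply: measurable_funD; [exact: m2|apply: measurable_funM => //; exact: m2].
have mL : measurable_fun setT L.
  apply: measurable_funM => //; apply: measurable_funM; first exact: m2.
  exact: (measurableT_comp mg mAB).
have mRh : measurable_fun setT Rh.
  apply: measurable_funM; first by apply: measurable_funM; exact: m2.
  exact: (measurableT_comp mg' mAB).
have aL : all_moments P (fun w => L (X i w, rest i w)).
  by apply: all_momentsM => //; apply: all_momentsM.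
have aR : all_moments P (fun w => Rh (X i w, rest i w)).
  by apply: all_momentsM => //; apply: all_momentsM.
have := independence_Fubini mL (all_moments_integrable aL).
have := independence_Fubini mRh (all_moments_integrable aR).
rewrite !ExE//.
have -> : (\int[distribution P [the {mfun _ >-> _} of rest i]]_z
     \int[distribution P (X i)]_x (Rh (x, z))%:E =
   \int[distribution P [the {mfun _ >-> _} of rest i]]_z
     \int[distribution P (X i)]_x (L (x, z))%:E)%E.
  apply: eq_integral => z _; rewrite /Rh /L /=.
  set a := A' z; set b := B' z; set c := u' z.
  (* [h] includes the factor 1 / s of the normalized coordinate; its derivative brings another 1 /
     s, and together they cancel the s^2 of [normal_ibp]. *)
  pose h (x : R) := (s i)^-1 * (c * g (a + x * ((s i)^-1 * b))).
  pose h' (x : R) := (s i)^- 2 * (c * b * g' (a + x * ((s i)^-1 * b))).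
  have dh (x : R) : is_derive x 1 h (h' x).
    have H : is_derive x 1 (fun x : R => a + x * ((s i)^-1 * b)) ((s i)^-1 * b).
      by apply: is_derive_eq; rewrite /GRing.scale/=; ring.
    have := @is_derive1_comp _ g (fun x : R => a + x * ((s i)^-1 * b)) x _ _ (dg _) H.
    move=> /(is_deriveZ ((s i)^-1 * c)) H'.
    have -> : h = ((s i)^-1 * c) \*: (g \o (fun x : R => a + x * ((s i)^-1 * b))).
      by apply/funext => y; rewrite /h /= mulrA.
    by apply: (is_derive_eq H'); rewrite /h' /GRing.scale/=; field.
  have th : tempered h.
    apply: temperedM; [exact: tempered_cst|apply: temperedM; first exact: tempered_cst].
    exact: tempered_affine.
  have th' : tempered h'.
    apply: temperedM; [exact: tempered_cst|apply: temperedM; first exact: tempered_cst].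
    exact: tempered_affine.
  have caff : continuous (fun x : R => a + x * ((s i)^-1 * b)).
    move=> x; apply: cvgD; first exact: cvg_cst.
    by apply: cvgM; [exact: cvg_id|exact: cvg_cst].
  have ch' : continuous h'.
    move=> x; apply: cvgM; first exact: cvg_cst.
    apply: cvgM; first exact: cvg_cst.
    by apply: (cvg_comp _ g' (caff x)); exact: cg'.
  have ch := is_derive_continuous dh.
  have mh : measurable_fun setT h by exact: continuous_measurable_fun.
  have mh' : measurable_fun setT h' by exact: continuous_measurable_fun.
  have E1 := normal_ibp (s_gt0 i) dh ch' th th'.
  have mxh : measurable_fun setT (fun x : R => x * h x) by exact: measurable_funM.
  have txh : tempered (fun x : R => x * h x) by apply: temperedM => //; exact: tempered_id.
  have msh' : measurable_fun setT (fun x : R => s i ^+ 2 * h' x) by exact: measurable_funM.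
  have tsh' : tempered (fun x : R => s i ^+ 2 * h' x).
    by apply: temperedM => //; exact: tempered_cst.
  have [E2 _] := integral_law i mxh txh.
  have [E3 _] := integral_law i msh' tsh'.
  transitivity (\int[distribution P (X i)]_x (s i ^+ 2 * h' x)%:E)%E.
    apply: eq_integral => x _; congr (_%:E); rewrite /h' mulrA divff ?sqrf_eq0// mul1r.
    by rewrite (_ : x * ((s i)^-1 * b) = (s i)^-1 * x * b)//; ring.
  rewrite E3 -E1 -E2; apply: eq_integral => x _; congr (_%:E).
  rewrite /h (_ : x * ((s i)^-1 * b) = (s i)^-1 * x * b); first by ring.
  by ring.
by move=> <- [] ->.
Qed.

End gaussian_family.

(** * Gaussian systems, characterized by integration by parts *)

Section gaussian_system.
Context d (Omega : measurableType d) (R : realType) (P : probability Omega R).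
Variables (n : nat) (xi : 'I_n -> Omega -> R) (ind : 'I_n -> (Omega -> R) -> Prop).

(* [ind i U] is meant as: U is a function of the variables other than [xi i].
   Independence and the law of [xi i] enter only through [gs_ibp], integration
   by parts in [xi i] conditionally on the other variables. *)
Record gaussian_system : Prop := GaussianSystem {
  gs_moments : forall i, all_moments P (xi i) ;
  gs_cst : forall i c, ind i (fun=> c) ;
  gs_coord : forall i j, j != i -> ind i (xi j) ;
  gs_add : forall i U V, ind i U -> ind i V -> ind i (fun w => U w + V w) ;
  gs_mul : forall i U V, ind i U -> ind i V -> ind i (fun w => U w * V w) ;
  gs_ibp : forall i (u A B : Omega -> R) (g g' : R -> R),
    ind i u -> ind i A -> ind i B ->
    all_moments P u -> all_moments P A -> all_moments P B ->
    (forall x : R, is_derive x 1 g (g' x)) -> continuous g' ->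
    tempered g -> tempered g' ->
    Ex P (fun w => xi i w * (u w * g (A w + xi i w * B w))) =
    Ex P (fun w => u w * B w * g' (A w + xi i w * B w))
}.

Hypothesis xi_gs : gaussian_system.

Lemma ind_sum i (I : Type) (r : seq I) (p : pred I) (Y : I -> Omega -> R) :
  (forall j, p j -> ind i (Y j)) -> ind i (fun w => \sum_(j <- r | p j) Y j w).
Proof.
move=> iY; elim: r => [|j r IH].
  rewrite (_ : (fun w => _) = fun=> 0); first exact: gs_cst.
  by apply/funext => w; rewrite big_nil.
rewrite (_ : (fun w => _) = fun w => if p j then Y j w + \sum_(k <- r | p k) Y k w
  else \sum_(k <- r | p k) Y k w); last by apply/funext => w; rewrite big_cons.
by case: (boolP (p j)) => // pj; apply: gs_add => //; exact: iY.
Qed.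

Lemma ind_prod i (I : Type) (r : seq I) (p : pred I) (Y : I -> Omega -> R) :
  (forall j, p j -> ind i (Y j)) -> ind i (fun w => \prod_(j <- r | p j) Y j w).
Proof.
move=> iY; elim: r => [|j r IH].
  rewrite (_ : (fun w => _) = fun=> 1); first exact: gs_cst.
  by apply/funext => w; rewrite big_nil.
rewrite (_ : (fun w => _) = fun w => if p j then Y j w * \prod_(k <- r | p k) Y k w
  else \prod_(k <- r | p k) Y k w); last by apply/funext => w; rewrite big_cons.
by case: (boolP (p j)) => // pj; apply: gs_mul => //; exact: iY.
Qed.

Lemma ind_exp i Y k : ind i Y -> ind i (fun w => Y w ^+ k).
Proof.
move=> iY; elim: k => [|k IH]; first exact: gs_cst.
by under eq_fun do rewrite exprS; exact: gs_mul.
Qed.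

Lemma gaussian_moment1 i u : ind i u -> all_moments P u ->
  Ex P (fun w => xi i w * u w) = 0.
Proof.
move=> iu au.
have := gs_ibp xi_gs iu (gs_cst xi_gs i 0) (gs_cst xi_gs i 1) au (all_moments_cst _ 0)
  (all_moments_cst _ 1) (fun x => @is_derive_cst _ R R 1 x 1).
move=> /(_ (fun x => cvg_cst _) (tempered_cst _) (tempered_cst _)).
rewrite (eq_Ex P (g := fun w => xi i w * u w)); last by move=> w; rewrite /= mulr1.
by move=> ->; rewrite -[RHS](Ex_cst P 0); apply: eq_Ex => w; rewrite mulr0.
Qed.

(** Integration by parts with g = x^(k + 1), A = 0 and B = 1: the moment recursion of the standard
    Gaussian, conditionally on the other variables. *)
Lemma gaussian_momentS i u k : ind i u -> all_moments P u ->
  Ex P (fun w => xi i w ^+ k.+2 * u w) = k.+1%:R * Ex P (fun w => xi i w ^+ k * u w).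
Proof.
move=> iu au; have ax := gs_moments xi_gs i.
have := gs_ibp xi_gs iu (gs_cst xi_gs i 0) (gs_cst xi_gs i 1) au (all_moments_cst _ 0)
  (all_moments_cst _ 1) (is_derive_exprS k)
  (@continuous_derive_exprS R k) (temperedX _ tempered_id)
  (temperedM (tempered_cst _) (temperedX _ tempered_id)).
rewrite (eq_Ex P (g := fun w => xi i w ^+ k.+2 * u w)); last first.
  by move=> w; rewrite add0r mulr1 (exprS _ k.+1); ring.
move=> ->; rewrite -ExZ; last by apply: all_momentsM => //; exact: all_momentsX.
by apply: eq_Ex => w; rewrite add0r !mulr1; ring.
Qed.

Lemma gaussian_moment2 i u : ind i u -> all_moments P u ->
  Ex P (fun w => xi i w ^+ 2 * u w) = Ex P u.
Proof.
move=> iu au; rewrite gaussian_momentS// mul1r.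
by apply: eq_Ex => w; rewrite mul1r.
Qed.

End gaussian_system.

(** * Square-free polynomials and their derivatives *)

Section multilinear.
Context d (Omega : measurableType d) (R : realType) (P : probability Omega R).
Variables (n : nat) (xi : 'I_n -> Omega -> R) (ind : 'I_n -> (Omega -> R) -> Prop).
Hypothesis xi_gs : gaussian_system P xi ind.
Local Notation E := (Ex P).
Local Notation am := (all_moments P).
Implicit Types (S W : {set 'I_n}) (a : {set 'I_n} -> R).

Definition mono S (w : Omega) : R := \prod_(i in S) xi i w.

(** Indexing coefficients by finite sets builds in that no variable is repeated. *)
Definition mlin a (w : Omega) : R := \sum_S a S * mono S w.

Definition homog (p : nat) a := forall S, a S != 0 -> #|S| = p.

(** With [mderiv], the two parts of F = A + xi_i D, both free of xi_i. D is the partial derivative: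
    its coefficient at S is that of F at S with i added. *)
Definition mdrop (i : 'I_n) a S := if i \in S then 0 else a S.

Definition mderiv (i : 'I_n) a S := if i \in S then 0 else a (i |: S).

Lemma am_mono S : am (mono S).
Proof. by apply: all_moments_prod => i _; exact: (gs_moments xi_gs). Qed.

Lemma am_mlin a : am (mlin a).
Proof. by apply: all_moments_sum => S _; apply: all_momentsZ; exact: am_mono. Qed.

Lemma ind_mono i S : i \notin S -> ind i (mono S).
Proof.
move=> iS; apply: (ind_prod xi_gs) => j jS; apply: (gs_coord xi_gs).
by apply: contraNneq iS => <-.
Qed.

Lemma ind_mlin i a : (forall S, i \in S -> a S = 0) -> ind i (mlin a).
Proof.
move=> a0; apply: (ind_sum xi_gs) => S _.
have [iS|iS] := boolP (i \in S).
  under eq_fun do rewrite a0// mul0r; exact: (gs_cst xi_gs).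
exact: (gs_mul xi_gs (gs_cst xi_gs i (a S)) (ind_mono iS)).
Qed.

Lemma ind_mdrop i a : ind i (mlin (mdrop i a)).
Proof. by apply: ind_mlin => S iS; rewrite /mdrop iS. Qed.

Lemma ind_mderiv i a : ind i (mlin (mderiv i a)).
Proof. by apply: ind_mlin => S iS; rewrite /mderiv iS. Qed.

Lemma mlin_mderivE i a w :
  mlin (mderiv i a) w = \sum_(S : {set 'I_n} | i \in S) a S * mono (S :\ i) w.
Proof.
rewrite /mlin (bigID (fun S : {set 'I_n} => i \in S))/= big1 ?add0r; last first.
  by move=> S iS; rewrite /mderiv iS mul0r.
rewrite [RHS](reindex_onto (fun S => i |: S) (fun S => S :\ i)); last first.
  by move=> S iS; rewrite finset.setD1K.
apply: eq_big => [S|S iS].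
  rewrite finset.setU11/=; apply/idP/eqP => [iS|<-]; last by rewrite finset.setD11.
  by rewrite finset.setU1K.
by rewrite /mderiv (negbTE iS) finset.setU1K.
Qed.

Lemma mlin_derivM i a w :
  xi i w * mlin (mderiv i a) w = \sum_(S : {set 'I_n} | i \in S) a S * mono S w.
Proof.
rewrite mlin_mderivE big_distrr/=; apply: eq_bigr => S iS.
by rewrite mulrCA /mono [in RHS](big_setD1 i).
Qed.

Lemma mlin_split i a w :
  mlin a w = mlin (mdrop i a) w + xi i w * mlin (mderiv i a) w.
Proof.
rewrite mlin_derivM {1}/mlin (bigID (fun S => i \in S))/= addrC; congr (_ + _).
rewrite /mlin [RHS](bigID (fun S => i \in S))/= [X in X + _]big1 ?add0r.
  by apply: eq_bigr => S iS; rewrite /mdrop (negbTE iS).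
by move=> S iS; rewrite /mdrop iS mul0r.
Qed.

(** Euler's identity: after the sums are exchanged, the monomial of S occurs once per element of S,
    that is p times. It writes p F as a sum ready for integration by parts variable by variable. *)
Lemma mlin_euler p a w : homog p a ->
  \sum_i xi i w * mlin (mderiv i a) w = p%:R * mlin a w.
Proof.
move=> ha; under eq_bigr do rewrite mlin_derivM.
rewrite (exchange_big_dep predT)//= big_distrr/=; apply: eq_bigr => S _.
have [->|aS] := eqVneq (a S) 0; first by rewrite mul0r mulr0 big1// => i _; rewrite mul0r.
by rewrite sumr_const (ha S aS) mulr_natl.
Qed.

Lemma homog_mderiv p i a : homog p.+1 a -> homog p (mderiv i a).
Proof.
move=> ha S; rewrite /mderiv; case: ifPn => [|iS]; first by rewrite eqxx.
by move=> /ha; rewrite cardsU1 iS add1n => -[].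
Qed.

Lemma homog_mdrop p i a : homog p a -> homog p (mdrop i a).
Proof. by move=> ha S; rewrite /mdrop; case: ifPn => [|_ /ha//]; rewrite eqxx. Qed.

Lemma homog0E a w : homog 0 a -> mlin a w = a finset.set0.
Proof.
move=> ha; rewrite /mlin (bigD1 finset.set0)//= /mono big_set0 mulr1 big1 ?addr0// => S S0.
have [->|/ha/eqP] := eqVneq (a S) 0; first by rewrite mul0r.
by rewrite cards_eq0 (negbTE S0).
Qed.

End multilinear.

(** * Sixth moment of a chaos *)

Section hypercontractivity.
Context d (Omega : measurableType d) (R : realType) (P : probability Omega R).
Local Notation E := (Ex P).
Local Notation am := (all_moments P).

(* Hoelder's inequality with exponents 3/2 and 3, obtained from weighted AM-GM. *)
Lemma Ex_mixed_le (U V : Omega -> R) (a b : R) : am U -> am V ->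
  (forall w, 0 <= U w) -> (forall w, 0 <= V w) -> 0 <= a -> 0 <= b ->
  E (fun w => U w ^+ 3) <= a ^+ 3 -> E (fun w => V w ^+ 3) <= b ^+ 3 ->
  E (fun w => U w ^+ 2 * V w) <= a ^+ 2 * b.
Proof.
move=> aU aV U0 V0 a0 b0 Ua Vb.
(* The AM-GM weights t / s and s^2 / t^2 require positive s and t, so a and b are first enlarged and
   then recovered as a small [eps] is removed. *)
have strict s t : 0 < s -> 0 < t -> a <= s -> b <= t ->
    E (fun w => U w ^+ 2 * V w) <= s ^+ 2 * t.
  move=> s0 t0 as_ bt.
  have aU3 := all_momentsX 3 aU; have aV3 := all_momentsX 3 aV.
  apply: (@le_trans _ _
      (E (fun w => 2 / 3 * (t / s) * U w ^+ 3 + 1 / 3 * (s ^+ 2 / t ^+ 2) * V w ^+ 3))).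
    apply: Ex_le; [|apply: all_momentsD; exact: all_momentsZ|].
      by apply: all_momentsM => //; exact: all_momentsX.
    move=> w; set u := U w / s; set v := V w / t.
    have u0 : 0 <= u by rewrite divr_ge0// ltW.
    have v0 : 0 <= v by rewrite divr_ge0// ltW.
    have -> : U w = u * s by rewrite divfK// gt_eqF.
    have -> : V w = v * t by rewrite divfK// gt_eqF.
    have -> : 2 / 3 * (t / s) * (u * s) ^+ 3 + 1 / 3 * (s ^+ 2 / t ^+ 2) * (v * t) ^+ 3 =
      s ^+ 2 * t * ((2 * u ^+ 3 + v ^+ 3) / 3) by field; rewrite !gt_eqF.
    have -> : (u * s) ^+ 2 * (v * t) = s ^+ 2 * t * (u ^+ 2 * v) by ring.
    apply: ler_wpM2l; first by rewrite mulr_ge0// ?exprn_ge0// ltW.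
    have -> : (2 * u ^+ 3 + v ^+ 3) / 3 = u ^+ 2 * v + (u - v) ^+ 2 * (2 * u + v) / 3 by field.
    by rewrite lerDl divr_ge0// mulr_ge0 ?sqr_ge0// addr_ge0// mulr_ge0.
  rewrite ExD; [|exact: all_momentsZ..]; rewrite !ExZ//.
  have Us : E (fun w => U w ^+ 3) <= s ^+ 3.
    by apply: le_trans Ua _; rewrite lerXn2r ?nnegrE// ltW.
  have Vt : E (fun w => V w ^+ 3) <= t ^+ 3.
    by apply: le_trans Vb _; rewrite lerXn2r ?nnegrE// ltW.
  have -> : s ^+ 2 * t = 2 / 3 * (t / s) * s ^+ 3 + 1 / 3 * (s ^+ 2 / t ^+ 2) * t ^+ 3.
    by field; rewrite !gt_eqF.
  have s0' := ltW s0; have t0' := ltW t0.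
  by apply: lerD; apply: ler_wpM2l => //; rewrite !mulr_ge0 ?invr_ge0 ?exprn_ge0.
apply/ler_addgt0Pr => e e0.
(* Chosen so that (a + eps)^2 (b + eps) <= a^2 b + eps C whenever eps <= 1. *)
pose C := a ^+ 2 + (2 * a + 1) * (b + 1).
have C0 : 0 <= C by rewrite addr_ge0 ?sqr_ge0// mulr_ge0// addr_ge0// mulr_ge0.
pose eps := Num.min 1 (e / (C + 1)).
have eps0 : 0 < eps by rewrite lt_min ltr01/= divr_gt0// ltr_wpDl.
have eps1 : eps <= 1 by rewrite ge_min lexx.
have epsC : eps * C <= e.
  apply: (@le_trans _ _ (eps * (C + 1))); first by rewrite ler_wpM2l ?lerDl// ltW.
  by rewrite -ler_pdivlMr ?ltr_wpDl// /eps ge_min lexx orbT.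
apply: le_trans (strict (a + eps) (b + eps) _ _ _ _) _; rewrite ?lerDl ?(ltW eps0)//.
- by rewrite ltr_wpDl.
- by rewrite ltr_wpDl.
apply: (@le_trans _ _ (a ^+ 2 * b + eps * C)); last by rewrite lerD2l.
rewrite -subr_ge0.
have -> : a ^+ 2 * b + eps * C - (a + eps) ^+ 2 * (b + eps) =
   eps * ((1 - eps) * (b + eps) + (2 * a + 1) * (1 - eps)) by rewrite /C; ring.
rewrite mulr_ge0 ?(ltW eps0)// addr_ge0// mulr_ge0// ?subr_ge0//.
  by rewrite addr_ge0// ltW.
by rewrite addr_ge0// mulr_ge0.
Qed.

Variables (n : nat) (xi : 'I_n -> Omega -> R) (ind : 'I_n -> (Omega -> R) -> Prop).
Hypothesis xi_gs : gaussian_system P xi ind.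

Lemma Ex_sqr_affine i (A B : Omega -> R) : ind i A -> ind i B -> am A -> am B ->
  E (fun w => (A w + xi i w * B w) ^+ 2) =
  E (fun w => A w ^+ 2) + E (fun w => B w ^+ 2).
Proof.
move=> iA iB aA aB; have ax := gs_moments xi_gs i.
rewrite (eq_Ex P (g := fun w =>
    A w ^+ 2 + (xi i w * (2 * (A w * B w)) + xi i w ^+ 2 * B w ^+ 2))); last first.
  by move=> w; ring.
have aA2 := all_momentsX 2 aA; have aB2 := all_momentsX 2 aB.
have aAB : am (fun w => 2 * (A w * B w)) by apply: all_momentsZ; exact: all_momentsM.
have axAB := all_momentsM ax aAB; have axB := all_momentsM (all_momentsX 2 ax) aB2.
rewrite ExD//; last exact: all_momentsD.
rewrite ExD// (gaussian_moment1 xi_gs) ?(gaussian_moment2 xi_gs) ?add0r//.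
  exact: (ind_exp xi_gs).
by apply: (gs_mul xi_gs); [exact: (gs_cst xi_gs)|exact: (gs_mul xi_gs)].
Qed.

(** The Gaussian moments 1, 3, 15 of orders 2, 4, 6, times the binomials 15, 15, 1, give 15, 45, 15;
    odd orders vanish. *)
Lemma Ex_exp6_affine i (A B : Omega -> R) : ind i A -> ind i B -> am A -> am B ->
  E (fun w => (A w + xi i w * B w) ^+ 6) =
  E (fun w => A w ^+ 6) + 15 * E (fun w => A w ^+ 4 * B w ^+ 2) +
  45 * E (fun w => A w ^+ 2 * B w ^+ 4) + 15 * E (fun w => B w ^+ 6).
Proof.
move=> iA iB aA aB; have ax := gs_moments xi_gs i.
pose u (k : nat) w := 'C(6, k)%:R * (A w ^+ (6 - k) * B w ^+ k).
have iu k : ind i (u k).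
  apply: (gs_mul xi_gs); first exact: (gs_cst xi_gs).
  by apply: (gs_mul xi_gs); exact: (ind_exp xi_gs).
have au k : am (u k).
  by apply: all_momentsZ; apply: all_momentsM; exact: all_momentsX.
rewrite (eq_Ex P (g := fun w => \sum_(k < 7) xi i w ^+ k * u k w)); last first.
  move=> w; rewrite exprDn; apply: eq_bigr => k _.
  by rewrite /u exprMn -mulr_natl; ring.
rewrite Ex_sum; last by move=> k _; apply: all_momentsM => //; exact: all_momentsX.
have m1 k : E (fun w => xi i w ^+ 1 * u k w) = 0 by exact: (gaussian_moment1 xi_gs (iu k) (au k)).
have m0 k : E (fun w => xi i w ^+ 0 * u k w) = E (u k).
  by apply: eq_Ex => w; rewrite mul1r.
have v k (c : R) U : (forall w, u k w = c * U w) -> am U -> E (u k) = c * E U.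
  by move=> uE aU; rewrite -ExZ//; exact: eq_Ex.
have E0 : E (u 0%N) = 1 * E (fun w => A w ^+ 6).
  by apply: v => [w|]; [rewrite /u bin0; ring|exact: all_momentsX].
have E2 : E (u 2%N) = 15 * E (fun w => A w ^+ 4 * B w ^+ 2).
  by apply: v => [w //|]; apply: all_momentsM; exact: all_momentsX.
have E4 : E (u 4%N) = 15 * E (fun w => A w ^+ 2 * B w ^+ 4).
  by apply: v => [w //|]; apply: all_momentsM; exact: all_momentsX.
have E6 : E (u 6%N) = 1 * E (fun w => B w ^+ 6).
  by apply: v => [w|]; [rewrite /u binn; ring|exact: all_momentsX].
rewrite !big_ord_recl big_ord0/= !(gaussian_momentS xi_gs)// !m1 !m0.
rewrite /bump !leq0n !add1n E0 E2 E4 E6; ring.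
Qed.

(* Induction on the number of variables: for F = A + xi D with A, D independent
   of the standard Gaussian xi, E F^6 = E A^6 + 15 E A^4 D^2 + 45 E A^2 D^4 +
   15 E D^6, and the constant 5 is chosen so that this is dominated by the
   expansion of (x + 5 y)^3 with coefficients 1, 15, 75, 125. *)
Lemma hypercontractivity6 (p : nat) (a : {set 'I_n} -> R) : homog p a ->
  E (fun w => mlin xi a w ^+ 6) <= (5 ^+ p * E (fun w => mlin xi a w ^+ 2)) ^+ 3.
Proof.
(* Induction on the size of a set [W] containing every S with a nonzero coefficient; the degree is
   general because [mderiv] lowers it by one. *)
suff H m : forall q (b : {set 'I_n} -> R) (W : {set 'I_n}), #|W| = m -> homog q b ->
    (forall S, b S != 0 -> S \subset W) ->
    E (fun w => mlin xi b w ^+ 6) <= (5 ^+ q * E (fun w => mlin xi b w ^+ 2)) ^+ 3.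
  by move=> ha; apply: (H _ _ _ finset.setT erefl ha) => S _; exact: finset.subsetT.
(* For a constant the inequality holds since 5^q >= 1; this settles both an empty [W] and degree
   0. *)
have cst_case q (b : {set 'I_n} -> R) (c : R) : (forall w, mlin xi b w = c) ->
    E (fun w => mlin xi b w ^+ 6) <= (5 ^+ q * E (fun w => mlin xi b w ^+ 2)) ^+ 3.
  move=> bc; rewrite (eq_Ex P (g := fun=> c ^+ 6)); last by move=> w; rewrite bc.
  rewrite (eq_Ex P (f := fun w => _ ^+ 2) (g := fun=> c ^+ 2)); last by move=> w; rewrite bc.
  rewrite !Ex_cst (_ : 6 = 2 * 3)%N// exprM.
  have c2 := sqr_ge0 c; apply: lerXn2r; rewrite ?nnegrE//; first by rewrite mulr_ge0// exprn_ge0.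
  by rewrite ler_peMl// exprn_ege1// ler1n.
elim: m => [|m IH] q b W Wm hb bW.
  apply: (cst_case _ _ (b finset.set0)) => w; rewrite /mlin (bigD1 finset.set0)//=.
  rewrite /mono big_set0 mulr1 big1 ?addr0// => S S0.
  have [->|/bW] := eqVneq (b S) 0; first by rewrite mul0r.
  by move/eqP: Wm; rewrite cards_eq0 => /eqP ->; rewrite finset.subset0 (negbTE S0).
case: q hb => [|q] hb.
  by apply: (cst_case _ _ (b finset.set0)) => w; exact: homog0E.
have /card_gt0P[i iW] : (0 < #|W|)%N by rewrite Wm.
have Wi : #|W :\ i| = m by move: Wm; rewrite (cardsD1 i) iW add1n => -[].
pose A := mlin xi (mdrop i b); pose D := mlin xi (mderiv i b).
have aA : am A := am_mlin xi_gs _; have aD : am D := am_mlin xi_gs _.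
have iA : ind i A by exact: (ind_mdrop xi_gs).
have iD : ind i D by exact: (ind_mderiv xi_gs).
have FE : mlin xi b = fun w => A w + xi i w * D w.
  by apply/funext => w; exact: mlin_split.
have HA : E (fun w => A w ^+ 6) <= (5 ^+ q.+1 * E (fun w => A w ^+ 2)) ^+ 3.
  apply: (IH _ _ (W :\ i)) => //; first exact: homog_mdrop.
  move=> S; rewrite /mdrop; case: ifPn => [|iS /bW SW]; first by rewrite eqxx.
  by rewrite finset.subsetD1 SW.
have HD : E (fun w => D w ^+ 6) <= (5 ^+ q * E (fun w => D w ^+ 2)) ^+ 3.
  apply: (IH _ _ (W :\ i)) => //; first exact: homog_mderiv.
  move=> S; rewrite /mderiv; case: ifPn => [|iS /bW]; first by rewrite eqxx.
  by rewrite finset.subUset => /andP[_ SW]; rewrite finset.subsetD1 SW.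
rewrite FE (Ex_exp6_affine iA iD aA aD) (Ex_sqr_affine iA iD aA aD).
set x := 5 ^+ q.+1 * E (fun w => A w ^+ 2) in HA *.
set y := 5 ^+ q * E (fun w => D w ^+ 2) in HD *.
have x0 : 0 <= x by rewrite mulr_ge0 ?exprn_ge0 ?Ex_ge0// => w; exact: sqr_ge0.
have y0 : 0 <= y by rewrite mulr_ge0 ?exprn_ge0 ?Ex_ge0// => w; exact: sqr_ge0.
have e6 (U : Omega -> R) : (fun w => (U w ^+ 2) ^+ 3) = (fun w => U w ^+ 6).
  by apply/funext => w; rewrite -exprM.
have e4 (U V : Omega -> R) : (fun w => (U w ^+ 2) ^+ 2 * V w ^+ 2) = (fun w => U w ^+ 4 * V w ^+ 2).
  by apply/funext => w; rewrite -exprM.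
have aA2 := all_momentsX 2 aA; have aD2 := all_momentsX 2 aD.
(* Hoelder for the squares A^2 and D^2, whose third powers have the expectations bounded in [HA] and
   [HD]. *)
have H1 : E (fun w => A w ^+ 4 * D w ^+ 2) <= x ^+ 2 * y.
  by rewrite -e4; apply: Ex_mixed_le; rewrite ?e6// => w; exact: sqr_ge0.
have H2 : E (fun w => A w ^+ 2 * D w ^+ 4) <= x * y ^+ 2.
  rewrite mulrC (_ : (fun w => _) = (fun w => D w ^+ 4 * A w ^+ 2)); last first.
    by apply/funext => w; rewrite mulrC.
  by rewrite -e4; apply: Ex_mixed_le; rewrite ?e6// => w; exact: sqr_ge0.
(* D has degree q, one less than F, so one factor 5 is left over in front of [y]. *)
have -> : 5 ^+ q.+1 * (E (fun w => A w ^+ 2) + E (fun w => D w ^+ 2)) = x + 5 * y.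
  by rewrite /x /y exprS; ring.
apply: (@le_trans _ _ (x ^+ 3 + 15 * (x ^+ 2 * y) + 45 * (x * y ^+ 2) + 15 * y ^+ 3)).
  by do ?apply: lerD => //; rewrite ler_wpM2l.
rewrite -subr_ge0.
have -> : (x + 5 * y) ^+ 3 - (x ^+ 3 + 15 * (x ^+ 2 * y) + 45 * (x * y ^+ 2) + 15 * y ^+ 3) =
  30 * x * y ^+ 2 + 110 * y ^+ 3 by ring.
clearbody x y.
by rewrite addr_ge0// !mulr_ge0 ?exprn_ge0.
Qed.

End hypercontractivity.

(** * Gamma and the Hermite expansion of F^2 *)

Section gamma.
Context d (Omega : measurableType d) (R : realType) (P : probability Omega R).
Local Notation E := (Ex P).
Local Notation am := (all_moments P).
Variables (n : nat) (xi : 'I_n -> Omega -> R) (ind : 'I_n -> (Omega -> R) -> Prop).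
Hypothesis xi_gs : gaussian_system P xi ind.

Definition hermite3 (t : 'I_3) (x : R) : R :=
  if t == 0%N :> nat then 1 else if t == 1%N :> nat then x else x ^+ 2 - 1.

(** Coefficients, in the basis 1, x, x^2 - 1, of a product of two factors each equal to x or 1. Two
    factors x give x^2 = H_2 + H_0, hence every index but 1. *)
Definition linearization (b b' : bool) (t : 'I_3) : R :=
  if b && b' then (t != 1%N :> nat)%:R
  else if b (+) b' then (t == 1%N :> nat)%:R else (t == 0%N :> nat)%:R.

Lemma linearizationE (b b' : bool) (x : R) :
  \sum_t linearization b b' t * hermite3 t x = (if b then x else 1) * (if b' then x else 1).
Proof.
rewrite !big_ord_recl big_ord0 /linearization /hermite3 /=.
by case: b; case: b' => /=; ring.
Qed.

Definition hermite_prod (al : {ffun 'I_n -> 'I_3}) (w : Omega) : R :=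
  \prod_i hermite3 (al i) (xi i w).

Definition linear_coef (S T : {set 'I_n}) (al : {ffun 'I_n -> 'I_3}) : R :=
  \prod_i linearization (i \in S) (i \in T) (al i).

Lemma monoM S T w : mono xi S w * mono xi T w =
  \sum_al linear_coef S T al * hermite_prod al w.
Proof.
rewrite /mono (big_mkcond (fun i => i \in S)) (big_mkcond (fun i => i \in T)) -big_split/=.
under eq_bigr do rewrite -linearizationE.
rewrite bigA_distr_bigA/=; apply: eq_bigr => al _.
by rewrite big_split.
Qed.

Lemma am_hermite3 j (t : 'I_3) : am (fun w => hermite3 t (xi j w)).
Proof.
have ax := gs_moments xi_gs j; case: t => [[|[|[|//]]] ?]; rewrite /hermite3/=.
- exact: all_moments_cst.
- exact: ax.
- by apply: all_momentsB; [exact: all_momentsX|exact: all_moments_cst].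
Qed.

Lemma ind_hermite3 i j (t : 'I_3) : j != i -> ind i (fun w => hermite3 t (xi j w)).
Proof.
move=> /(gs_coord xi_gs) ix; case: t => [[|[|[|//]]] ?]; rewrite /hermite3/=.
- exact: (gs_cst xi_gs).
- exact: ix.
- exact: (gs_add xi_gs (ind_exp xi_gs 2 ix) (gs_cst xi_gs i (-1))).
Qed.

Lemma am_hermite_prod al : am (hermite_prod al).
Proof. by apply: all_moments_prod => i _; exact: am_hermite3. Qed.

(** The factor [r], free of xi_i, stands for all other coordinates, so that one coordinate where two
    multi-indices differ suffices for orthogonality. *)
Lemma hermite3_orthogonal i (s t : 'I_3) (r : Omega -> R) : s != t -> ind i r -> am r ->
  E (fun w => hermite3 s (xi i w) * hermite3 t (xi i w) * r w) = 0.
Proof.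
have wlog_lt (s' t' : 'I_3) : (s' < t')%N -> ind i r -> am r ->
    E (fun w => hermite3 s' (xi i w) * hermite3 t' (xi i w) * r w) = 0.
  move=> + ir ar; have ax := gs_moments xi_gs i.
  have axr := all_momentsM ax ar.
  have ax2r := all_momentsM (all_momentsX 2 ax) ar.
  have ax3r := all_momentsM (all_momentsX 3 ax) ar.
  have m1 := gaussian_moment1 xi_gs ir ar.
  have m2 := gaussian_moment2 xi_gs ir ar.
  have m3 : E (fun w => xi i w ^+ 3 * r w) = 0.
    by rewrite (gaussian_momentS xi_gs) // m1 mulr0.
  case: s' => [[|[|[|//]]] hs]; case: t' => [[|[|[|//]]] ht] //= _; rewrite /hermite3/=.
  - by rewrite -[RHS]m1; apply: eq_Ex => w; rewrite mul1r.
  - rewrite (eq_Ex P (g := fun w => xi i w ^+ 2 * r w - r w)); last by move=> w; ring.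
    by rewrite ExB// m2 subrr.
  - rewrite (eq_Ex P (g := fun w => xi i w ^+ 3 * r w - xi i w * r w)); last by move=> w; ring.
    by rewrite ExB// m1 m3 subrr.
move=> st ir ar; have [lt|lt|/val_inj/eqP] := ltngtP s t; last by rewrite (negbTE st).
  exact: wlog_lt.
by rewrite -[RHS](wlog_lt t s)//; apply: eq_Ex => w; rewrite [X in X * _]mulrC.
Qed.

Lemma hermite_prod_orthogonal al be : al != be ->
  E (fun w => hermite_prod al w * hermite_prod be w) = 0.
Proof.
move=> /eqP alb; have [i abi] : exists i, al i != be i.
  apply: contrapT => H; apply: alb; apply/ffunP => i; apply/eqP/negP => Hi.
  by apply: H; exists i; apply/negP.
pose r w := \prod_(j | j != i) (hermite3 (al j) (xi j w) * hermite3 (be j) (xi j w)).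
have ir : ind i r.
  by apply: (ind_prod xi_gs) => j ji; exact: (gs_mul xi_gs (ind_hermite3 _ ji) (ind_hermite3 _ ji)).
have ar : am r.
  by apply: all_moments_prod => j ji; exact: (all_momentsM (am_hermite3 _ _) (am_hermite3 _ _)).
rewrite -[RHS](hermite3_orthogonal abi ir ar); apply: eq_Ex => w.
by rewrite /hermite_prod -big_split/= (bigD1 i).
Qed.

Variables (p : nat) (a : {set 'I_n} -> R).
Hypothesis ha : homog p a.
Local Notation F := (mlin xi a).

Definition gamma (w : Omega) : R := \sum_i mlin xi (mderiv i a) w ^+ 2.

Lemma am_gamma : am gamma.
Proof. by apply: all_moments_sum => i _; apply: all_momentsX; exact: am_mlin xi_gs _. Qed.

(* In a product of monomials S and T, each common variable contributes
   xi_i^2 = H_2 + H_0, whereas in the corresponding term of (d_i F)^2 it is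
   absent, which is the H_0 part.  Hence Gamma multiplies the component [al] of
   F^2 by the number of common variables carrying H_0, that is p - |al| / 2. *)
Definition chaos_weight (al : {ffun 'I_n -> 'I_3}) : R :=
  p%:R - (\sum_i (al i : nat))%:R / 2.

Definition sqr_coef al : R := \sum_S \sum_T a S * a T * linear_coef S T al.

Lemma mlin_sqrE w : F w ^+ 2 = \sum_al sqr_coef al * hermite_prod al w.
Proof.
rewrite expr2 /mlin big_distrlr/=.
under [RHS]eq_bigr do rewrite /sqr_coef big_distrl/=.
rewrite [RHS]exchange_big/=; apply: eq_bigr => S _.
under [RHS]eq_bigr do rewrite big_distrl/=.
rewrite [RHS]exchange_big/=; apply: eq_bigr => T _.
rewrite mulrACA monoM big_distrr/=; apply: eq_bigr => al _.
by rewrite mulrA.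
Qed.

(** A nonzero coefficient forces, in each coordinate, [i in S] + [i in T] = al_i + 2
    [i in both and al_i = 0]; summing over i gives 2 p = |al| plus twice the count. *)
Lemma weight_count (S T : {set 'I_n}) al : #|S| = p -> #|T| = p -> linear_coef S T al != 0 ->
  chaos_weight al = (\sum_(i in S :&: T) (al i == 0%N :> nat))%:R.
Proof.
move=> hS hT kne; rewrite /chaos_weight.
suff H : (2 * p = \sum_i (al i : nat) + 2 * \sum_(i in S :&: T) (al i == 0%N :> nat))%N.
  have := congr1 (fun k : nat => k%:R : R) H; rewrite natrD !natrM => H'.
  by apply: (mulfI (x := 2)) => //; rewrite mulrBr mulrCA divff// mulr1 H' addrC addKr.
have -> : (2 * p = \sum_(i < n) ((i \in S) + (i \in T)))%N.
  rewrite big_split/= mul2n -addnn -{1}hS -hT -!sum1_card.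
  by congr (_ + _)%N; rewrite big_mkcond/=; apply: eq_bigr => i _; case: ifP.
rewrite big_distrr/= [X in (_ + X)%N]big_mkcond -big_split/=.
apply: eq_bigr => i _; move: kne => /prodf_neq0 /(_ i isT).
rewrite /linearization finset.in_setI.
by case: (i \in S); case: (i \in T); case: (al i) => [[|[|[|//]]] ?] //=; rewrite eqxx.
Qed.

(** At i the product 1 = H_0 replaces x^2 = H_2 + H_0, so only the components with al_i = 0 survive,
    with unchanged coefficient. *)
Lemma linear_coef_drop (S T : {set 'I_n}) al i : i \in S -> i \in T ->
  linear_coef (S :\ i) (T :\ i) al = (al i == 0%N :> nat)%:R * linear_coef S T al.
Proof.
move=> iS iT; rewrite /linear_coef (bigD1 i)//= [in RHS](bigD1 i)//= mulrA.
congr (_ * _).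
  rewrite /linearization !finset.setD11 iS iT /=.
  by case: (al i) => [[|[|[|//]]] ?]; rewrite /= ?mulr1 ?mul0r ?mul1r.
by apply: eq_bigr => j ji; rewrite /linearization !finset.in_setD1 ji.
Qed.

Lemma mlin_deriv_sqr i w : mlin xi (mderiv i a) w ^+ 2 =
  \sum_(S : {set 'I_n} | i \in S) \sum_(T : {set 'I_n} | i \in T)
     a S * a T * (mono xi (S :\ i) w * mono xi (T :\ i) w).
Proof.
rewrite expr2 mlin_mderivE big_distrlr/=; do 2 apply: eq_bigr => ? _.
by rewrite mulrACA.
Qed.

Lemma gammaE w : gamma w = \sum_al chaos_weight al * sqr_coef al * hermite_prod al w.
Proof.
rewrite /gamma.
transitivity (\sum_S \sum_T \sum_(i in S :&: T)
    a S * a T * (mono xi (S :\ i) w * mono xi (T :\ i) w)).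
  under eq_bigr do rewrite mlin_deriv_sqr.
  rewrite (exchange_big_dep predT)//=; apply: eq_bigr => S _.
  rewrite (exchange_big_dep predT)//=; apply: eq_bigr => T _.
  by apply: eq_bigl => i; rewrite finset.in_setI.
under [RHS]eq_bigr do rewrite /sqr_coef big_distrr big_distrl/=.
rewrite [RHS]exchange_big/=; apply: eq_bigr => S _.
under [RHS]eq_bigr do rewrite big_distrr big_distrl/=.
rewrite [RHS]exchange_big/=; apply: eq_bigr => T _.
transitivity (\sum_al \sum_(i in S :&: T)
    a S * a T * (linear_coef (S :\ i) (T :\ i) al * hermite_prod al w)).
  rewrite exchange_big/=; apply: eq_bigr => i _.
  by rewrite monoM big_distrr.
apply: eq_bigr => al _.
(* [weight_count] needs sets of size p and a nonzero coefficient; where one of the coefficients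
   vanishes, both sides are 0. *)
have [a0|aST] := eqVneq (a S * a T) 0.
  by rewrite a0 mul0r mulr0 mul0r big1// => i _; rewrite mul0r.
have [k0|kne] := eqVneq (linear_coef S T al) 0.
  rewrite k0 !mulr0 mul0r big1// => i; rewrite finset.in_setI => /andP[iS iT].
  by rewrite linear_coef_drop// k0 mulr0 mul0r mulr0.
have [/ha hS /ha hT] : a S != 0 /\ a T != 0.
  by apply/andP; rewrite -negb_or -mulf_eq0.
rewrite (weight_count hS hT kne) natr_sum 2!big_distrl/=.
apply: eq_bigr => i; rewrite finset.in_setI => /andP[iS iT].
by rewrite linear_coef_drop//; ring.
Qed.

(** For arbitrary [al] the weight may be negative; where the coefficient of F^2 is nonzero, some
    pair S, T contributes and the weight is a count. *)
Lemma sqr_coef_weight al : sqr_coef al != 0 -> 0 <= chaos_weight al <= p%:R.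
Proof.
move=> c0; apply/andP; split; last first.
  by rewrite /chaos_weight gerBl divr_ge0.
have [S [T]] : exists S T, a S * a T * linear_coef S T al != 0.
  apply: contrapT => H; move/eqP: c0; apply; apply: big1 => S _; apply: big1 => T _.
  by apply/eqP/negPn/negP => ne; apply: H; exists S, T.
rewrite !mulf_eq0 !negb_or => /andP[/andP[/ha hS /ha hT] kne].
by rewrite (weight_count hS hT kne).
Qed.

(** By orthogonality E[Gamma (p F^2 - Gamma)] is the sum of the terms w_al (p - w_al) c_al^2
    E[e_al^2], each of them nonnegative. *)
Lemma gamma_sqr_le : E (fun w => gamma w ^+ 2) <= p%:R * E (fun w => gamma w * F w ^+ 2).
Proof.
have aF := am_mlin xi_gs a; have aG := am_gamma.
rewrite -subr_ge0 -ExZ; last by apply: all_momentsM => //; exact: all_momentsX.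
rewrite -ExB; first last.
- exact: all_momentsX.
- by apply: all_momentsZ; apply: all_momentsM => //; exact: all_momentsX.
rewrite (eq_Ex P (g := fun w => \sum_al \sum_be
   (chaos_weight al * sqr_coef al * ((p%:R - chaos_weight be) * sqr_coef be)) *
    (hermite_prod al w * hermite_prod be w))); last first.
  move=> w; transitivity (gamma w * (p%:R * F w ^+ 2 - gamma w)); first by ring.
  rewrite mlin_sqrE {2}gammaE big_distrr/= -sumrB {1}gammaE big_distrlr/=.
  by do 2 (apply: eq_bigr => ? _); ring.
have aab al be c : am (fun w => c * (hermite_prod al w * hermite_prod be w)).
  by apply: all_momentsZ; apply: all_momentsM; exact: am_hermite_prod.
rewrite Ex_sum; last by move=> al _; apply: all_moments_sum => be _; exact: aab.
apply: sumr_ge0 => al _; rewrite Ex_sum; last by move=> be _; exact: aab.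
rewrite (bigD1 al)//= big1 ?addr0 => [|be alb]; last first.
  rewrite ExZ; last by apply: all_momentsM; exact: am_hermite_prod.
  by rewrite hermite_prod_orthogonal ?mulr0// eq_sym.
rewrite ExZ; last by apply: all_momentsM; exact: am_hermite_prod.
have [->|/sqr_coef_weight/andP[w0 wp]] := eqVneq (sqr_coef al) 0.
  by rewrite !mulr0 mul0r.
apply: mulr_ge0; last by apply: Ex_ge0 => w; rewrite -expr2 sqr_ge0.
by rewrite mulrACA -expr2 mulr_ge0 ?sqr_ge0// mulr_ge0// subr_ge0.
Qed.

End gamma.

(** * Stein's bound for a chaos *)

Section stein_chaos.
Context d (Omega : measurableType d) (R : realType) (P : probability Omega R).
Local Notation E := (Ex P).
Local Notation am := (all_moments P).
Variables (n : nat) (xi : 'I_n -> Omega -> R) (ind : 'I_n -> (Omega -> R) -> Prop).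
Hypothesis xi_gs : gaussian_system P xi ind.
Variables (p : nat) (a : {set 'I_n} -> R).
Hypothesis ha : homog p a.
Local Notation F := (mlin xi a).
Local Notation G := (gamma xi a).

(** In the term xi_i D g(F) of Euler's identity, F = A + xi_i D; integration by parts in xi_i with u
    = B = D leaves D^2 g'(F), and these add up to Gamma g'(F). *)
Lemma chaos_ibp (g g' : R -> R) : (forall x : R, is_derive x 1 g (g' x)) ->
  continuous g' -> tempered g -> tempered g' ->
  p%:R * E (fun w => F w * g (F w)) = E (fun w => G w * g' (F w)).
Proof.
move=> dg cg' tg tg'.
have aF := am_mlin xi_gs a.
have mg := continuous_measurable_fun (is_derive_continuous dg).
have mg' : measurable_fun setT g' by exact: continuous_measurable_fun.
have agF := all_moments_comp aF mg tg; have ag'F := all_moments_comp aF mg' tg'.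
have aD i := am_mlin xi_gs (mderiv i a).
have ax := gs_moments xi_gs.
rewrite -ExZ; last exact: all_momentsM aF agF.
rewrite (eq_Ex P (g := fun w => \sum_i xi i w * (mlin xi (mderiv i a) w * g (F w)))); last first.
  move=> w; rewrite mulrA -(mlin_euler _ w ha) big_distrl/=.
  by apply: eq_bigr => i _; rewrite mulrA.
rewrite Ex_sum; last first.
  by move=> i _; exact: all_momentsM (ax i) (all_momentsM (aD i) agF).
rewrite (eq_Ex P (f := fun w => G w * _)
    (g := fun w => \sum_i mlin xi (mderiv i a) w ^+ 2 * g' (F w))); last first.
  by move=> w; rewrite /gamma big_distrl.
rewrite Ex_sum; last first.
  by move=> i _; exact: all_momentsM (all_momentsX 2 (aD i)) ag'F.
apply: eq_bigr => i _.
have := gs_ibp xi_gs (ind_mderiv xi_gs i a) (ind_mdrop xi_gs i a) (ind_mderiv xi_gs i a)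
  (aD i) (am_mlin xi_gs _) (aD i) dg cg' tg tg'.
have FE w : mlin xi (mdrop i a) w + xi i w * mlin xi (mderiv i a) w = F w.
  by rewrite -mlin_split.
rewrite (eq_Ex P (g := fun w => xi i w * (mlin xi (mderiv i a) w * g (F w)))); last first.
  by move=> w; rewrite FE.
by move=> ->; apply: eq_Ex => w; rewrite FE expr2.
Qed.

Lemma gamma_mean : p%:R * E (fun w => F w ^+ 2) = E G.
Proof.
have did (x : R) : is_derive x 1 id (1 : R) by exact: is_derive_id.
have := chaos_ibp did (fun x => cvg_cst _) tempered_id (tempered_cst 1).
rewrite (eq_Ex P (g := fun w => F w ^+ 2)); last by move=> w; rewrite expr2.
by move=> ->; apply: eq_Ex => w; rewrite mulr1.
Qed.

Lemma gamma_fourth_moment :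
  p%:R * E (fun w => F w ^+ 4) = 3 * E (fun w => G w * F w ^+ 2).
Proof.
have := chaos_ibp (is_derive_exprS 2) (@continuous_derive_exprS R 2) (temperedX 3 tempered_id)
  (temperedM (tempered_cst 3) (temperedX 2 tempered_id)).
rewrite (eq_Ex P (g := fun w => F w ^+ 4)); last by move=> w; rewrite [RHS]exprS.
move=> ->; rewrite -ExZ; last first.
  by apply: all_momentsM; [exact: (am_gamma xi_gs)|apply: all_momentsX; exact: (am_mlin xi_gs)].
by apply: eq_Ex => w; rewrite mulrCA.
Qed.

Lemma stein_chaos_bound (psi : R -> R) (K : R) : (0 < p)%N -> continuous psi ->
  (forall x, `|psi x| <= K) ->
  (\int[normal_prob 0 1]_x (psi x)%:E = 0)%E ->
  E (psi \o F) ^+ 2 <= (2 * K) ^+ 2 *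
    (1 - 2 * E (fun w => F w ^+ 2) + E (fun w => F w ^+ 4) / 3).
Proof.
move=> p0 cpsi psiK Ipsi.
have K0 : 0 <= K := le_trans (normr_ge0 _) (psiK 0).
have pR : (p%:R : R) != 0 by rewrite pnatr_eq0 -lt0n.
have [g [dg xgK tg]] := stein_solution cpsi psiK Ipsi.
have cg := is_derive_continuous dg.
pose g' x := x * g x + psi x.
have cg' : continuous g'.
  move=> x; apply: cvgD; last exact: cpsi.
  by apply: cvgM; [exact: cvg_id|exact: cg].
have g'K x : `|g' x| <= 2 * K.
  by rewrite (le_trans (ler_normD _ _))// mulr_natl mulr2n lerD.
have tg' : tempered g' by exists (2 * K), 0%N => x; rewrite expr0 mulr1.
have tpsi : tempered psi by exists K, 0%N => x; rewrite expr0 mulr1.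
have aF := am_mlin xi_gs a; have aG := am_gamma xi_gs a.
have mg := continuous_measurable_fun cg; have mg' := continuous_measurable_fun cg'.
have mpsi := continuous_measurable_fun cpsi.
have agF := all_moments_comp aF mg tg; have ag'F := all_moments_comp aF mg' tg'.
have apF := all_moments_comp aF mpsi tpsi.
have aFg := all_momentsM aF agF; have aGg := all_momentsM aG ag'F.
pose V w := 1 - p%:R^-1 * G w.
have aV : am V.
  by apply: all_momentsB; [exact: all_moments_cst|exact: all_momentsZ].
(* Stein's equation replaces psi(F) by g'(F) - F g(F), and integration by parts replaces F g(F) by
   Gamma g'(F) / p under the expectation. *)
have Epsi : E (psi \o F) = E (fun w => g' (F w) * V w).
  rewrite (eq_Ex P (g := fun w => g' (F w) - F w * g (F w))); last first.
    by move=> w /=; rewrite /g' addrAC subrr add0r.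
  rewrite ExB//; have := chaos_ibp dg cg' tg tg'.
  move=> /(congr1 (fun x => p%:R^-1 * x)); rewrite mulrA mulVf// mul1r => ->.
  rewrite -ExZ// -ExB//; last exact: all_momentsZ.
  by apply: eq_Ex => w; rewrite /V /= /g'; ring.
have agV := all_momentsM ag'F aV.
(* Nonnegativity of the variance; with the square inside, g' can be bounded pointwise. *)
have CS : E (fun w => g' (F w) * V w) ^+ 2 <= E (fun w => (g' (F w) * V w) ^+ 2).
  set m := E (fun w => g' (F w) * V w).
  have : 0 <= E (fun w => (g' (F w) * V w - m) ^+ 2) by apply: Ex_ge0 => w; exact: sqr_ge0.
  have agV2 := all_momentsX 2 agV.
  rewrite (eq_Ex P (g := fun w =>
      (g' (F w) * V w) ^+ 2 - (2 * m * (g' (F w) * V w) - m ^+ 2))); last first.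
    by move=> w; ring.
  rewrite ExB//; last by apply: all_momentsB; [exact: all_momentsZ|exact: all_moments_cst].
  rewrite ExB; [|exact: all_momentsZ|exact: all_moments_cst].
  rewrite ExZ// Ex_cst -/m; lra.
rewrite Epsi (le_trans CS)//.
apply: (@le_trans _ _ (E (fun w => (2 * K) ^+ 2 * V w ^+ 2))).
  apply: Ex_le; [exact: all_momentsX|apply: all_momentsZ; exact: all_momentsX|].
  move=> w; rewrite exprMn ler_wpM2r ?sqr_ge0// -(real_normK (num_real (g' _))).
  by rewrite lerXn2r ?nnegrE ?mulr_ge0.
rewrite ExZ; last exact: all_momentsX.
rewrite ler_wpM2l ?sqr_ge0//.
have aG2 := all_momentsX 2 aG.
rewrite (eq_Ex P (g := fun w => 1 - (2 * p%:R^-1 * G w - p%:R^-1 ^+ 2 * G w ^+ 2))); last first.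
  by move=> w; rewrite /V; ring.
rewrite ExB; [|exact: all_moments_cst|by apply: all_momentsB; exact: all_momentsZ].
rewrite ExB; [|exact: all_momentsZ|exact: all_momentsZ].
rewrite Ex_cst !ExZ// -gamma_mean.
have := gamma_sqr_le xi_gs ha; have := gamma_fourth_moment.
set y := E (fun w => G w * _); set f4 := E _; set g2 := E _; set f2 := E _.
move=> H4 H2.
have -> : f4 = 3 * y / p%:R by rewrite -H4 mulrC mulKf.
have -> : 2 / p%:R * (p%:R * f2) = 2 * f2 by rewrite mulrA divfK.
have : p%:R^-1 ^+ 2 * g2 <= y / p%:R.
  apply: (@le_trans _ _ (p%:R^-1 ^+ 2 * (p%:R * y))); first by rewrite ler_wpM2l ?sqr_ge0.
  by rewrite expr2 -mulrA mulKf// mulrC.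
set ip := p%:R^-1; lra.
Qed.
End stein_chaos.

(** * Linear operations on homogeneous chaoses *)

Section chaos_closure.
Context d (Omega : measurableType d) (R : realType) (n : nat) (xi : 'I_n -> Omega -> R) (p : nat).

Definition is_chaos (Y : Omega -> R) :=
  exists2 a : {set 'I_n} -> R, homog p a & Y =1 mlin xi a.

Lemma chaos0 : is_chaos (fun=> 0).
Proof.
exists (fun=> 0) => [S|w]; first by rewrite eqxx.
by rewrite /mlin big1// => S _; rewrite mul0r.
Qed.

Lemma chaosZ c Y : is_chaos Y -> is_chaos (fun w => c * Y w).
Proof.
move=> [a ha YE]; exists (fun S => c * a S) => [S|w].
  by rewrite mulf_eq0 negb_or => /andP[_ /ha].
by rewrite YE /mlin big_distrr/=; apply: eq_bigr => S _; rewrite mulrA.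
Qed.

Lemma chaosD Y Z : is_chaos Y -> is_chaos Z -> is_chaos (fun w => Y w + Z w).
Proof.
move=> [a ha YE] [b hb ZE]; exists (fun S => a S + b S) => [S|w].
  have [->|/ha//] := eqVneq (a S) 0; rewrite add0r; exact: hb.
by rewrite YE ZE /mlin -big_split/=; apply: eq_bigr => S _; rewrite mulrDl.
Qed.

Lemma chaos_sum (I : Type) (r : seq I) (q : pred I) (Y : I -> Omega -> R) :
  (forall i, q i -> is_chaos (Y i)) -> is_chaos (fun w => \sum_(i <- r | q i) Y i w).
Proof.
move=> cY; elim: r => [|i r IH].
  rewrite (_ : (fun w => _) = fun=> 0); first exact: chaos0.
  by apply/funext => w; rewrite big_nil.
rewrite (_ : (fun w => _) = fun w => if q i then Y i w + \sum_(k <- r | q k) Y k w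
  else \sum_(k <- r | q k) Y k w); last by apply/funext => w; rewrite big_cons.
by case: (boolP (q i)) => // qi; apply: chaosD => //; exact: cY.
Qed.

Lemma chaos_mono (S : {set 'I_n}) : #|S| = p -> is_chaos (mono xi S).
Proof.
move=> Sp; exists (fun S' => (S' == S)%:R) => [S'|w].
  by have [->//|_] := eqVneq S' S; rewrite eqxx.
rewrite /mlin (bigD1 S)//= eqxx mul1r big1 ?addr0// => S' /negbTE ->.
by rewrite mul0r.
Qed.

End chaos_closure.

(** * Simple integrals as polynomials in normalized increments *)

Section simple_integral_chaos.
Context d (Omega : measurableType d) (R : realType) (P : probability Omega R).
Variables (T : R) (B : R -> {RV P >-> R}).
Hypothesis B_bm : brownian_motion T B.

Section partition.
Variables (n : nat) (t : nat -> R).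
Hypothesis t_itv : forall k, (k <= n)%N -> 0 <= t k <= T.
Hypothesis t_inc : forall k, (k < n)%N -> t k < t k.+1.

Let X (k : 'I_n) := increment B (t k) (t k.+1).
Let s (k : 'I_n) : R := Num.sqrt (t k.+1 - t k).

Let s_gt0 k : 0 < s k.
Proof. by rewrite sqrtr_gt0 subr_gt0 t_inc. Qed.

Lemma brownian_gaussian_system :
  gaussian_system P (std_coord X s) (rest_fun X).
Proof.
have X_indep : mutually_independent X.
  by apply: (bm_independent B_bm) => // k kn; exact/ltW/t_inc.
have X_law i (A : set R) : measurable A ->
    distribution P (X i) A = normal_prob 0 (s i) A.
  move=> mA; have /andP[t0 _] := t_itv (ltnW (ltn_ord i)).
  have /andP[_ tT] := t_itv (ltn_ord i).
  exact: (bm_gaussian B_bm t0 (t_inc (ltn_ord i)) tT mA).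
split.
- by move=> i; exact: all_moments_std_coord.
- by move=> i c; exact: rest_fun_cst.
- move=> i j ji; apply: rest_funM; [exact: rest_fun_cst|exact: rest_fun_coord].
- by move=> i U V; exact: rest_funD.
- by move=> i U V; exact: rest_funM.
- by move=> i u A B' g g'; exact: gaussian_ibp.
Qed.

Lemma partition_lt i j : (i < j)%N -> (j <= n)%N -> t i < t j.
Proof.
elim: j => // j IH; rewrite ltnS leq_eqVlt => /predU1P[->|ij] jn; first exact: t_inc.
by apply: lt_trans (t_inc jn); apply: IH => //; exact: ltnW.
Qed.

Lemma partition_le i j : (i <= n)%N -> (j <= n)%N -> (t i <= t j) = (i <= j)%N.
Proof.
move=> i_n jn; case: (ltngtP i j) => [ij|ji|->]; last by rewrite lexx.
  by rewrite ltW// partition_lt.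
by apply/negbTE; rewrite -ltNge partition_lt.
Qed.

(** Cells are selected by comparing endpoints as reals rather than indices, so that the index set
    can be written directly with [sk_lo] and [sk_hi]. *)
Lemma increment_sum (i j : nat) w : (i <= j)%N -> (j <= n)%N ->
  B (t j) w - B (t i) w =
  \sum_(k : 'I_n | (t i <= t k) && (t k.+1 <= t j)) s k * std_coord X s k w.
Proof.
move=> ij jn; rewrite -(telescope_sumr (fun k => B (t k) w) ij).
rewrite (big_nat_widen _ _ n)// big_geq_mkord; apply: eq_big => k.
  by rewrite /= andbC !partition_le// ?(leq_trans ij)// ltnW.
by move=> _; rewrite /std_coord mulrA divff ?mul1r// gt_eqF.
Qed.

(** Each side of a rectangle is cut into cells, and expanding the product gives one term per choice
    [f] of a cell for each coordinate. Avoiding the diagonal forces the chosen cells to be distinct,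
    so every term is a square-free monomial of degree p. *)
Lemma simple_integral_chaos p (g : simple_kernel T p) :
  (forall (k : 'I_(sk_size g)) i, exists2 l, (l <= n)%N & sk_lo k i = t l) ->
  (forall (k : 'I_(sk_size g)) i, exists2 l, (l <= n)%N & sk_hi k i = t l) ->
  is_chaos (std_coord X s) p (simple_integral B g).
Proof.
move=> lo_t hi_t; apply: chaos_sum => k _; apply: chaosZ.
pose K (i : 'I_p) := [pred l : 'I_n | (sk_lo k i <= t l) && (t l.+1 <= sk_hi k i)].
rewrite (_ : (fun w => _) = fun w => \sum_(f in family K)
    (\prod_i s (f i)) * \prod_i std_coord X s (f i) w); last first.
  apply/funext => w.
  transitivity (\prod_(i < p) \sum_(l | K i l) s l * std_coord X s l w).
    apply: eq_bigr => i _; rewrite /K /=.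
    have [l ln El] := lo_t k i; have [m mn Em] := hi_t k i.
    have [_ lohi _] := sk_cube k i.
    rewrite El Em increment_sum// -(partition_le ln mn) -El -Em//.
  rewrite bigA_distr_big_dep/=; apply: eq_bigr => f _.
  by rewrite big_split.
apply: chaos_sum => f fK; apply: chaosZ.
have finj : injective f.
  move=> i j fij; apply/eqP/negPn/negP => ij.
  have Ki (l : 'I_p) : sk_lo k l <= t (f l) <= sk_hi k l.
    have /andP[-> hi] := familyP fK l.
    by rewrite (le_trans _ hi)// ltW// t_inc.
  (* If coordinates i and j chose the same cell, its left end would lie in both sides; this value at
     i and j, with lower ends elsewhere, would give a diagonal point of the rectangle. *)
  have : (box (sk_lo k) (sk_hi k) `&` diagonal_set (p := p))
      [tuple if l \in [:: i; j] then t (f i) else sk_lo k l | l < p].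
    split=> [l|].
      rewrite tnth_mktuple !inE; case: ifPn => [/orP[]/eqP ->//|_].
        by rewrite fij.
      by rewrite lexx/=; have [] := sk_cube k l.
    by exists i, j; split => //; rewrite !tnth_mktuple !inE !eqxx orbT.
  by rewrite sk_offdiagonal.
have -> : (fun w => \prod_i std_coord X s (f i) w) = mono (std_coord X s) (f @: finset.setT).
  apply/funext => w; rewrite /mono big_imset//=.
    by apply: eq_bigl => i; rewrite finset.in_setT.
  by move=> i j _ _; exact: finj.
by apply: chaos_mono; rewrite card_imset// cardsT card_ord.
Qed.
End partition.

Lemma common_partition (s : seq R) : 0 <= T -> (forall x, x \in s -> 0 <= x <= T) ->
  exists n (t : nat -> R), [/\ forall k, (k <= n)%N -> 0 <= t k <= T,
    forall k, (k < n)%N -> t k < t k.+1 &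
    forall x, x \in s -> exists2 l, (l <= n)%N & x = t l].
Proof.
(* [undup] makes the points strictly increasing; the added 0 makes the list nonempty, so that
   [(size st).-1] is its last index. *)
move=> T0 sT; pose st := sort <=%O (undup (0 :: s)).
have mst x : (x \in st) = (x \in 0 :: s) by rewrite mem_sort mem_undup.
have srt : sorted <%O st by rewrite sort_lt_sorted undup_uniq.
have st0 : (0 < size st)%N.
  by have := mst 0; rewrite inE eqxx; case: (st).
exists (size st).-1, (fun k => nth 0 st k); split=> [k kn|k kn|x xs].
- have : nth 0 st k \in st by rewrite mem_nth// -(prednK st0) ltnS.
  by rewrite mst inE => /predU1P[->|/sT//]; rewrite lexx.
- rewrite lt_sorted_ltn_nth// inE -(prednK st0) ltnS//; exact: ltnW.
- have xst : x \in st by rewrite mst inE xs orbT.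
  exists (index x st); last by rewrite nth_index.
  by rewrite -ltnS prednK// index_mem.
Qed.

Lemma simple_integral_is_chaos p (g : simple_kernel T p) : 0 <= T ->
  exists n (xi : 'I_n -> Omega -> R) (ind : 'I_n -> (Omega -> R) -> Prop),
  gaussian_system P xi ind /\ is_chaos xi p (simple_integral B g).
Proof.
move=> T0.
pose ends :=
  codom (fun x : 'I_(sk_size g) * 'I_p => sk_lo x.1 x.2) ++
  codom (fun x : 'I_(sk_size g) * 'I_p => sk_hi x.1 x.2).
have endsT x : x \in ends -> 0 <= x <= T.
  rewrite mem_cat => /orP[]/codomP[[l i] ->/=]; have [lo0 lohi hiT] := sk_cube l i.
    by rewrite lo0 (le_trans lohi).
  by rewrite hiT (le_trans lo0).
have [n [t [t_itv t_inc s_t]]] := @common_partition ends T0 endsT.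
exists n, (std_coord (fun k : 'I_n => increment B (t k) (t k.+1))
    (fun k : 'I_n => Num.sqrt (t k.+1 - t k))), (rest_fun (fun k : 'I_n => increment B (t k) (t k.+1))).
split; first exact: brownian_gaussian_system.
apply: simple_integral_chaos => // k i; apply: s_t; rewrite mem_cat; apply/orP.
- by left; apply/codomP; exists (k, i).
- by right; apply/codomP; exists (k, i).
Qed.

End simple_integral_chaos.

(** * Two tools for limits *)

Section real_lemmas.
Context {R : realType}.

(** Only [x] is confined to a compact interval. In the application [y] is a value of the
    approximating variable, on which there is no pointwise bound. *)
Lemma heine (phi : R -> R) (M e : R) : continuous phi -> 0 < e ->
  exists2 eta : R, 0 < eta & forall x y, `|x| <= M -> `|x - y| < eta -> `|phi x - phi y| <= e.
Proof.
move=> cphi e0.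
have /compact_near_coveringP cov := @segment_compact R (- M) M.
pose Q (eta x : R) := forall y, `|x - y| < eta -> `|phi x - phi y| <= e.
have := cov R (at_right (0 : R)) Q _.
have H : forall x, `[- M, M]%classic x -> \forall x' \near x & eta \near (at_right (0 : R)), Q eta x'.
  move=> x _.
  have e20 : 0 < e / 2 by rewrite divr_gt0.
  have /cvgrPdist_lt /(_ _ e20) := cphi x.
  move=> /nbhs_ballP[r /= r0 Hr].
  have r20 : 0 < r / 2 by rewrite divr_gt0.
  exists (ball x (r / 2), [set eta | 0 < eta < r / 2]) => /=.
    split; first by exact: nbhsx_ballx.
    near=> eta; apply/andP; split; near: eta; [exact: nbhs_right_gt|exact: nbhs_right_lt].
  move=> [x' eta] /= [xx' /andP[eta0 etar]] y x'y.
  have h1 : `|phi x - phi x'| < e / 2.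
    by apply: Hr; rewrite /ball/= (lt_trans xx')// ltr_pdivrMr// ltr_pMr// ltr1n.
  have h2 : `|phi x - phi y| < e / 2.
    apply: Hr; rewrite /ball/= (_ : x - y = (x - x') + (x' - y)); last by ring.
    rewrite (le_lt_trans (ler_normD _ _))// [r]splitr ltrD//.
    exact: lt_trans x'y etar.
  rewrite (_ : phi x' - phi y = (phi x - phi y) - (phi x - phi x')); last by ring.
  by rewrite (le_trans (ler_normB _ _))// [e]splitr ltW// ltrD.
move=> /(_ _ H) HH.
have : \forall eta \near at_right (0 : R), 0 < eta /\ forall x, `[- M, M]%classic x -> Q eta x.
  near=> eta; split; first by near: eta; exact: nbhs_right_gt.
  near: eta; exact: HH.
move=> /filter_ex[eta [eta0 Heta]]; exists eta => // x y xM; apply: Heta.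
by rewrite /= in_itv/= -ler_norml.
Unshelve. all: by end_near.
Qed.

(** Made for inequalities such as a b <= t a^2 + b^2 / t with a free parameter: [t] is fixed first
    to make [t * C] small, and only then, with [D] determined by [t], is [k] taken large. *)
Lemma interpolation_cvg (u e : nat -> R) (l C : R) : 0 <= C ->
  (forall k, 0 <= e k) -> e @ \oo --> 0 ->
  (forall t, 0 < t -> exists D, forall k, `|l - u k| <= t * C + D * e k) ->
  u @ \oo --> l.
Proof.
move=> C0 e0 cve H; apply/cvgrPdist_le => eps eps0.
pose t := eps / (2 * (C + 1)).
have C1 : 0 < C + 1 by rewrite ltr_wpDl.
have t0 : 0 < t by rewrite divr_gt0// mulr_gt0.
have [D HD] := H t t0.
have tC : t * C <= eps / 2.
  have -> : eps / 2 = t * (C + 1) by rewrite /t; field; rewrite gt_eqF.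
  by rewrite ler_wpM2l ?lerDl// ltW.
have d0 : 0 < eps / (2 * (`|D| + 1)) by rewrite divr_gt0// mulr_gt0// ltr_wpDl.
move/cvgrPdist_le : cve => /(_ _ d0); apply: filterS => k.
rewrite sub0r normrN ger0_norm// => ek.
rewrite (le_trans (HD k))// [eps]splitr lerD//.
apply: (@le_trans _ _ ((`|D| + 1) * e k)).
  by rewrite ler_wpM2r// (le_trans (ler_norm _))// lerDl.
have D1 : 0 < `|D| + 1 by rewrite ltr_wpDl.
apply: le_trans (ler_wpM2l (ltW D1) ek) _.
by rewrite le_eqVlt; apply/orP; left; apply/eqP; field; rewrite gt_eqF.
Qed.

End real_lemmas.

(** * Passage to L^2-limits *)

Section chaotic.
Context d (Omega : measurableType d) (R : realType) (P : probability Omega R).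
Local Notation E := (Ex P).
Local Notation intg := (intg P).

(* The properties of degree-p chaoses that survive L^2-limits. *)
Record chaotic (p : nat) (Y : Omega -> R) : Prop := {
  chaotic_moments : all_moments P Y ;
  chaotic_hyper : E (fun w => Y w ^+ 6) <= (5 ^+ p * E (fun w => Y w ^+ 2)) ^+ 3 ;
  chaotic_stein : forall (psi : R -> R) (K : R), continuous psi ->
    (forall x, `|psi x| <= K) ->
    (\int[normal_prob 0 1]_x (psi x)%:E = 0)%E ->
    E (psi \o Y) ^+ 2 <= (2 * K) ^+ 2 *
      (1 - 2 * E (fun w => Y w ^+ 2) + E (fun w => Y w ^+ 4) / 3)
}.

Lemma continuous_truncated_power (j : nat) (c : R) :
  continuous (fun x : R => Num.min (x ^+ j) c).
Proof.
move=> x; apply: (@continuous_min _ _ (fun x : R => x ^+ j) (fun=> c)).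
  exact: exprn_continuous.
exact: cst_continuous.
Qed.

Lemma simple_integral_chaotic (T : R) (B : R -> {RV P >-> R}) (p : nat)
    (g : simple_kernel T p) : 0 <= T -> (0 < p)%N -> brownian_motion T B ->
  chaotic p (simple_integral B g).
Proof.
move=> T0 p0 Bbm.
have [n [xi [ind [gs [a ha gE]]]]] := simple_integral_is_chaos Bbm g T0.
have -> : simple_integral B g = mlin xi a by apply/funext.
split.
- exact: (am_mlin gs).
- exact: (hypercontractivity6 gs).
- by move=> psi K; exact: (stein_chaos_bound gs ha).
Qed.

Variables (p : nat) (F : Omega -> R) (Q : nat -> Omega -> R).
Hypothesis mF : measurable_fun setT F.
Hypothesis cQ : forall k, chaotic p (Q k).
Hypothesis FQ_int : forall k, intg (fun w => (F w - Q k w) ^+ 2).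
Let e k := E (fun w => (F w - Q k w) ^+ 2).
Hypothesis e_cvg0 : e @ \oo --> 0.

Let e_ge0 k : 0 <= e k.
Proof. by apply: Ex_ge0 => w; exact: sqr_ge0. Qed.

Let QX k j : intg (fun w => Q k w ^+ j).
Proof. by apply: am_intg; apply: all_momentsX; exact: chaotic_moments (cQ k). Qed.

Lemma F2_int : intg (fun w => F w ^+ 2).
Proof.
apply: (intg_le (g := fun w => 2 * Q 0 w ^+ 2 + 2 * (F w - Q 0 w) ^+ 2)).
- exact: measurable_funX.
- move=> w; rewrite ger0_norm ?sqr_ge0//.
  by have := sqr_ge0 (2 * Q 0 w - F w); nra.
- by apply: intgD; apply: intgZ; [exact: QX|exact: FQ_int].
Qed.

Lemma E2_cvg : (fun k => E (fun w => Q k w ^+ 2)) @ \oo --> E (fun w => F w ^+ 2).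
Proof.
have F2 := F2_int.
apply: (interpolation_cvg (e := e) (C := E (fun w => F w ^+ 2))) => //.
  by apply: Ex_ge0 => w; exact: sqr_ge0.
(* From |2 x h| <= t x^2 + h^2 / t; the 1 accounts for the remaining h^2. *)
move=> t t0; exists (1 + t^-1) => k.
rewrite /e -EintZ// -EintZ// -EintD; [|exact: intgZ|exact: intgZ].
apply: Eint_dist => //; first by apply: intgD; exact: intgZ.
move=> w; set x := F w; set h := x - Q k w.
have -> : Q k w = x - h by rewrite /h; ring.
have -> : x ^+ 2 - (x - h) ^+ 2 = 2 * x * h - h ^+ 2 by ring.
have a : 2 * x * h <= t * x ^+ 2 + t^-1 * h ^+ 2.
  rewrite -subr_ge0 (_ : _ - _ = t^-1 * (t * x - h) ^+ 2); last by field; rewrite gt_eqF.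
  by rewrite mulr_ge0 ?sqr_ge0// invr_ge0 ltW.
have b : - (2 * x * h) <= t * x ^+ 2 + t^-1 * h ^+ 2.
  rewrite -subr_ge0 (_ : _ - _ = t^-1 * (t * x + h) ^+ 2); last by field; rewrite gt_eqF.
  by rewrite mulr_ge0 ?sqr_ge0// invr_ge0 ltW.
have h2 := sqr_ge0 h.
by rewrite ler_norml mulrDl mul1r; apply/andP; split; lra.
Qed.

(** Three cases, with x = F and y = Q_k: a large |x| costs t x^2, a small |x - y| costs t by uniform
    continuity, and a large |x - y| costs a multiple of (x - y)^2. *)
Lemma Ebounded_cvg (phi : R -> R) (K : R) : continuous phi -> (forall x, `|phi x| <= K) ->
  (fun k => E (phi \o Q k)) @ \oo --> E (phi \o F).
Proof.
move=> cphi phiK; have F2 := F2_int.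
have K0 : 0 <= K := le_trans (normr_ge0 _) (phiK 0).
have mphi := continuous_measurable_fun cphi.
have iphi (Y : Omega -> R) : measurable_fun setT Y -> intg (phi \o Y).
  move=> mY; apply: (intg_le (g := fun=> K)); last exact: intg_cst.
    exact: measurableT_comp.
  by move=> w; exact: phiK.
apply: (interpolation_cvg (e := e) (C := 1 + E (fun w => F w ^+ 2))) => //.
  by rewrite addr_ge0//; apply: Ex_ge0 => w; exact: sqr_ge0.
move=> t t0.
(* Chosen so that 2 K <= t x^2 as soon as |x| > M. *)
pose M := Num.sqrt (2 * K / t).
have [eta eta0 Heta] := heine M cphi t0.
exists (2 * K / eta ^+ 2) => k.
have -> : 1 + E (fun w => F w ^+ 2) = E (fun w => 1 + F w ^+ 2).
  by rewrite EintD ?Ex_cst//; exact: intg_cst.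
have iD : intg (fun w => 1 + F w ^+ 2) by apply: intgD => //; exact: intg_cst.
rewrite /e -EintZ// -EintZ// -EintD; [|exact: intgZ|exact: intgZ].
have mQ : measurable_fun setT (Q k) by have [] := chaotic_moments (cQ k).
apply: Eint_dist; [exact: iphi|exact: iphi|by apply: intgD; exact: intgZ|].
move=> w /=; set x := F w; set y := Q k w.
have x2 := sqr_ge0 x; have h2 := sqr_ge0 (x - y).
have D0 : 0 <= 2 * K / eta ^+ 2 by rewrite divr_ge0 ?sqr_ge0// mulr_ge0.
have phi2K : `|phi x - phi y| <= 2 * K.
  by rewrite (le_trans (ler_normB _ _))// mulr_natl mulr2n lerD.
have [xM|xM] := leP `|x| M; last first.
  have : 2 * K <= t * x ^+ 2.
    rewrite -ler_pdivrMl// mulrC -(real_normK (num_real x)).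
    rewrite -[leLHS]sqr_sqrtr ?divr_ge0 ?mulr_ge0 ?(ltW t0)//.
    by rewrite lerXn2r ?nnegrE ?sqrtr_ge0// ltW.
  have := mulr_ge0 D0 h2; rewrite mulrDr mulr1; lra.
have [xy|xy] := ltP `|x - y| eta.
  have := Heta _ _ xM xy; have := mulr_ge0 D0 h2.
  have := mulr_ge0 (ltW t0) x2; rewrite mulrDr mulr1; lra.
have : 2 * K <= 2 * K / eta ^+ 2 * (x - y) ^+ 2.
  rewrite -mulrA ler_peMr ?mulr_ge0// mulrC ler_pdivlMr ?exprn_gt0// mul1r.
  by rewrite -(real_normK (num_real (x - y))) lerXn2r ?nnegrE// ltW.
have := mulr_ge0 (ltW t0) x2; rewrite mulrDr mulr1; lra.
Qed.

Lemma truncated_power_bound (j : nat) (c : R) : ~~ odd j -> 0 <= c ->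
  forall x : R, `|Num.min (x ^+ j) c| <= c.
Proof.
move=> j_even c0 x; have xj : 0 <= x ^+ j by rewrite exprn_even_ge0.
by rewrite ger0_norm ?le_min ?xj// ge_min lexx orbT.
Qed.

Let B6 : R := (5 ^+ p * E (fun w => F w ^+ 2)) ^+ 3.

(** Truncation makes x^6 bounded, so its expectation passes to the limit, while hypercontractivity
    along the approximation gives a bound that does not depend on the level [m]. *)
Lemma E6_truncated_le (m : nat) : E (fun w => Num.min (F w ^+ 6) m%:R) <= B6.
Proof.
have cm : continuous (fun x : R => Num.min (x ^+ 6) m%:R).
  exact: continuous_truncated_power.
have c1 := Ebounded_cvg cm (truncated_power_bound (j := 6) isT (ler0n _ m)).
have c2 : (fun k => (5 ^+ p * E (fun w => Q k w ^+ 2)) ^+ 3) @ \oo --> B6.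
  apply: (cvg_comp (fun k => 5 ^+ p * E (fun w => Q k w ^+ 2)) (fun x => x ^+ 3)).
    by apply: cvgM; [exact: cvg_cst|exact: E2_cvg].
  exact: exprn_continuous.
apply: (ler_cvg_to c1 c2); apply: nearW => k.
apply: le_trans (chaotic_hyper (cQ k)).
have aQ := chaotic_moments (cQ k).
apply: Eint_le; last by move=> w /=; rewrite ge_min lexx.
  apply: (intg_le (g := fun=> m%:R)); last exact: intg_cst.
    by apply: measurableT_comp; [exact: continuous_measurable_fun|case: aQ].
  by move=> w; exact: truncated_power_bound.
exact: QX.
Qed.

(** Monotone convergence as the truncation level grows; integrability and the bound come out
    together. *)
Lemma F6_le : intg (fun w => F w ^+ 6) /\ E (fun w => F w ^+ 6) <= B6.
Proof.
pose f_ (m : nat) w := (Num.min (F w ^+ 6) m%:R)%:E.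
have mf m : measurable_fun setT (fun w => Num.min (F w ^+ 6) m%:R).
  apply: (measurableT_comp (f := fun x : R => Num.min (x ^+ 6) m%:R)) => //.
  by apply: continuous_measurable_fun; exact: continuous_truncated_power.
have F60 w : 0 <= F w ^+ 6 by rewrite exprn_even_ge0.
have iF m : intg (fun w => Num.min (F w ^+ 6) m%:R).
  apply: (intg_le (g := fun=> m%:R)); [exact: mf| |exact: intg_cst].
  by move=> w; exact: truncated_power_bound.
have mcv := @cvg_monotone_convergence _ _ _ P setT measurableT f_.
have limf w : limn (f_ ^~ w) = (F w ^+ 6)%:E.
  apply/cvg_lim => //; apply: cvg_near_cst; near=> m.
  rewrite /f_; congr (_%:E); apply/min_idPl.
  by near: m; exact: nbhs_infty_ger.
have le6 : (\int[P]_w (F w ^+ 6)%:E <= B6%:E)%E.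
  have mcv' : (\int[P]_w f_ m w @[m --> \oo] --> \int[P]_w (F w ^+ 6)%:E)%E.
    rewrite (_ : (\int[P]_w (F w ^+ 6)%:E)%E = (\int[P]_w limn (f_ ^~ w))%E).
      apply: mcv.
      - by move=> m; exact/measurable_EFinP.
      - by move=> m w _; rewrite lee_fin le_min F60 ler0n.
      - move=> w _ m k mk; rewrite lee_fin le_min ge_min lexx/= ge_min.
        by rewrite ler_nat mk orbT.
    by apply: eq_integral => w _; rewrite limf.
  rewrite -(cvg_lim _ mcv')//; apply: lime_le; first by apply/cvg_ex; eexists; exact: mcv'.
  by apply: nearW => m; rewrite EintE// lee_fin E6_truncated_le.
have iF6 : intg (fun w => F w ^+ 6).
  apply/integrableP; split; first by apply/measurable_EFinP; exact: measurable_funX.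
  apply: (@le_lt_trans _ _ B6%:E); last exact: ltry.
  apply: le_trans le6; apply: ge0_le_integral => //.
  - by apply/measurable_EFinP/measurableT_comp => //; exact: measurable_funX.
  - by apply/measurable_EFinP; exact: measurable_funX.
  - by move=> w _; rewrite /= lee_fin ger0_norm.
by split=> //; rewrite -lee_fin -EintE.
Unshelve. all: by end_near.
Qed.

Lemma F4_int : intg (fun w => F w ^+ 4).
Proof.
have [F6 _] := F6_le; have F2 := F2_int.
apply: (intg_le (g := fun w => F w ^+ 2 + F w ^+ 6)); [exact: measurable_funX| |exact: intgD].
move=> w; rewrite ger0_norm ?exprn_even_ge0//.
rewrite -subr_ge0 (_ : _ - _ = F w ^+ 2 * ((F w ^+ 2 - 1) ^+ 2 + F w ^+ 2)); last by ring.
by rewrite mulr_ge0 ?addr_ge0 ?sqr_ge0.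
Qed.

(** x^4 - y^4 = (x - y) s with s = (x + y) (x^2 + y^2) and s^2 <= 8 (x^6 + y^6): the first factor
    tends to 0 in L^2, and the second is bounded in L^2 by the sixth moments. *)
Lemma E4_cvg : (forall k, e k <= 1) ->
  (fun k => E (fun w => Q k w ^+ 4)) @ \oo --> E (fun w => F w ^+ 4).
Proof.
move=> e1; have F2 := F2_int; have F4 := F4_int; have [F6 F6le] := F6_le.
(* From y^2 <= 2 x^2 + 2 (x - y)^2 and e k <= 1: a bound on second moments uniform in k, which
   hypercontractivity turns into one on sixth moments. *)
pose q := 2 * E (fun w => F w ^+ 2) + 2.
have EQ2 k : E (fun w => Q k w ^+ 2) <= q.
  apply: (@le_trans _ _ (2 * E (fun w => F w ^+ 2) + 2 * e k)); last first.
    by rewrite lerD2l -[leRHS]mulr1 ler_wpM2l.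
  rewrite /e -!EintZ// -EintD; [|exact: intgZ|exact: intgZ].
  apply: Eint_le; [exact: QX|by apply: intgD; exact: intgZ|].
  by move=> w; have := sqr_ge0 (2 * F w - Q k w); nra.
have E20 k : 0 <= E (fun w => Q k w ^+ 2) by apply: Ex_ge0 => w; exact: sqr_ge0.
have q0 : 0 <= q := le_trans (E20 0) (EQ2 0).
pose C := 2 * (B6 + (5 ^+ p * q) ^+ 3).
have EQ6 k : E (fun w => Q k w ^+ 6) <= (5 ^+ p * q) ^+ 3.
  apply: le_trans (chaotic_hyper (cQ k)) _.
  by rewrite lerXn2r ?nnegrE ?mulr_ge0 ?exprn_ge0// ler_wpM2l ?exprn_ge0.
have F60 : 0 <= E (fun w => F w ^+ 6) by apply: Ex_ge0 => w; rewrite exprn_even_ge0.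
have C0 : 0 <= C.
  have B60 : 0 <= B6 := le_trans F60 F6le.
  have q3 : 0 <= (5 ^+ p * q) ^+ 3 by rewrite exprn_ge0// mulr_ge0 ?exprn_ge0.
  by rewrite mulr_ge0// addr_ge0.
apply: (interpolation_cvg (e := e) (C := C)) => //.
move=> t t0; exists t^-1 => k.
apply: (@le_trans _ _
    (E (fun w => t * (2 * (F w ^+ 6 + Q k w ^+ 6)) + t^-1 * (F w - Q k w) ^+ 2))).
  apply: Eint_dist => //.
    apply: intgD; last by apply: intgZ; exact: FQ_int.
    by apply: intgZ; apply: intgZ; exact: intgD.
  move=> w; set x := F w; set y := Q k w.
  have x2 := sqr_ge0 x; have y2 := sqr_ge0 y.
  pose s := (x + y) * (x ^+ 2 + y ^+ 2); pose h := x - y.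
  have -> : x ^+ 4 - y ^+ 4 = h * s by rewrite /h /s; ring.
  have s2 : s ^+ 2 <= 8 * (x ^+ 6 + y ^+ 6).
    have a1 : s ^+ 2 <= 2 * (x ^+ 2 + y ^+ 2) ^+ 3.
      rewrite -subr_ge0 (_ : _ - _ = (x - y) ^+ 2 * (x ^+ 2 + y ^+ 2) ^+ 2); last by rewrite /s; ring.
      by rewrite mulr_ge0 ?sqr_ge0.
    apply: le_trans a1 _; rewrite -subr_ge0.
    rewrite (_ : _ - _ = 6 * ((x ^+ 2 + y ^+ 2) * (x ^+ 2 - y ^+ 2) ^+ 2)); last by ring.
    by rewrite mulr_ge0// mulr_ge0 ?addr_ge0 ?sqr_ge0.
  have a : h * s <= t^-1 * h ^+ 2 + t * (s ^+ 2 / 4).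
    rewrite -subr_ge0 (_ : _ - _ = t^-1 * (h - t * s / 2) ^+ 2); last by field; rewrite gt_eqF.
    by rewrite mulr_ge0 ?sqr_ge0// invr_ge0 ltW.
  have b : - (h * s) <= t^-1 * h ^+ 2 + t * (s ^+ 2 / 4).
    rewrite -subr_ge0 (_ : _ - _ = t^-1 * (h + t * s / 2) ^+ 2); last by field; rewrite gt_eqF.
    by rewrite mulr_ge0 ?sqr_ge0// invr_ge0 ltW.
  have c : t * (s ^+ 2 / 4) <= t * (2 * (x ^+ 6 + y ^+ 6)).
    by rewrite ler_wpM2l ?(ltW t0)//; lra.
  by rewrite -/h ler_norml; apply/andP; split; lra.
have iFQ : intg (fun w => F w ^+ 6 + Q k w ^+ 6) by exact: intgD.
rewrite EintD; [|by apply: intgZ; exact: intgZ|exact: intgZ].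
rewrite EintZ ?EintZ ?EintD//; [|exact: intgZ].
by rewrite lerD2r ler_wpM2l ?(ltW t0)// ler_wpM2l// lerD.
Qed.

Lemma stein_limit_bound (psi : R -> R) (K : R) : (forall k, e k <= 1) ->
  continuous psi -> (forall x, `|psi x| <= K) ->
  (\int[normal_prob 0 1]_x (psi x)%:E = 0)%E ->
  E (psi \o F) ^+ 2 <= (2 * K) ^+ 2 *
      (1 - 2 * E (fun w => F w ^+ 2) + E (fun w => F w ^+ 4) / 3).
Proof.
move=> e1 cpsi psiK Ipsi.
have c1 := Ebounded_cvg cpsi psiK.
have c2 : (fun k => E (psi \o Q k) ^+ 2) @ \oo --> E (psi \o F) ^+ 2.
  by apply: (cvg_comp _ (fun x => x ^+ 2) c1); exact: exprn_continuous.
have c3 : (fun k => (2 * K) ^+ 2 *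
      (1 - 2 * E (fun w => Q k w ^+ 2) + E (fun w => Q k w ^+ 4) / 3)) @ \oo -->
    (2 * K) ^+ 2 * (1 - 2 * E (fun w => F w ^+ 2) + E (fun w => F w ^+ 4) / 3).
  apply: cvgM; first exact: cvg_cst.
  apply: cvgD; last by apply: cvgM; [exact: E4_cvg|exact: cvg_cst].
  by apply: cvgB; [exact: cvg_cst|apply: cvgM; [exact: cvg_cst|exact: E2_cvg]].
apply: (ler_cvg_to c2 c3); apply: nearW => k.
exact: (chaotic_stein (cQ k)).
Qed.

End chaotic.

(** * Approximation of multiple integrals, and the equivalence *)

Section final.
Context d (Omega : measurableType d) (R : realType) (P : probability Omega R).
Local Notation E := (Ex P).
Local Notation intg := (intg P).

Lemma Lnorm2_sqr (f : Omega -> R) :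
  (Lnorm P 2%:E (fun w => (f w)%:E) `^ 2 = \int[P]_w (f w ^+ 2)%:E)%E.
Proof.
rewrite poweR_Lnorm//; apply: eq_integral => w _ /=.
by rewrite powR_mulrn// real_normK// num_real.
Qed.

Lemma cvg_EFinP (u : nat -> R) (l : R) :
  ((fun n => (u n)%:E) @ \oo --> l%:E) <-> (u @ \oo --> l).
Proof.
split=> [/fine_cvgP[_ //]|ul].
by apply/fine_cvgP; split => //; exact: nearW.
Qed.

(** The L^2-distances to the simple integrals are only eventually finite and at most 1; the sequence
    is shifted by such an [N], so that both hold for every k. *)
Lemma multiple_integral_chaotic_approx (T : R) (B : R -> {RV P >-> R}) (p : nat)
    (f : p.-tuple R -> R) (F : {RV P >-> R}) : 0 <= T -> (0 < p)%N ->
  brownian_motion T B -> is_multiple_integral B T f F ->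
  exists Q : nat -> Omega -> R, [/\ forall k, chaotic P p (Q k),
    forall k, intg (fun w => (F w - Q k w) ^+ 2),
    forall k, E (fun w => (F w - Q k w) ^+ 2) <= 1 &
    (fun k => E (fun w => (F w - Q k w) ^+ 2)) @ \oo --> 0].
Proof.
move=> T0 p0 Bbm [g [_ gF]].
pose l k := Lnorm P 2%:E (fun w => (F w - simple_integral B (g k) w)%:E).
have l0 k : (0 <= l k)%E by exact: Lnorm_ge0.
have /fine_cvgP[lfin lcvg] : l @ \oo --> 0%:E by exact: gF.
have : \forall k \near \oo, l k \is a fin_num /\ `|fine (l k)| <= 1.
  near=> k; split; near: k => //.
  move/cvgrPdist_le : lcvg => /(_ 1 ltr01); apply: filterS => k.
  by rewrite sub0r normrN.
move=> [N _ HN].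
have mQ k : measurable_fun setT (simple_integral B (g k)).
  by have [] := chaotic_moments (simple_integral_chaotic (g k) T0 p0 Bbm).
have IE k : (N <= k)%N -> (\int[P]_w ((F w - simple_integral B (g k) w) ^+ 2)%:E =
    (fine (l k) ^+ 2)%:E)%E.
  move=> /HN[fk _]; rewrite -Lnorm2_sqr -/(l k) -[in LHS](fineK fk).
  by rewrite poweR_EFin powR_mulrn// fine_ge0.
have II k : (N <= k)%N -> intg (fun w => (F w - simple_integral B (g k) w) ^+ 2).
  move=> Nk; apply/integrableP; split.
    by apply/measurable_EFinP; apply: measurable_funX; exact: measurable_funB.
  rewrite (eq_integral (fun w => ((F w - simple_integral B (g k) w) ^+ 2)%:E)).
    by rewrite IE// ltry.
  by move=> w _; rewrite /= ger0_norm// sqr_ge0.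
have EE k : (N <= k)%N -> E (fun w => (F w - simple_integral B (g k) w) ^+ 2) = fine (l k) ^+ 2.
  by move=> Nk; rewrite /Ex /Rintegral IE.
exists (fun k => simple_integral B (g (k + N)%N)); split=> [k|k|k|].
- exact: simple_integral_chaotic.
- by apply: II; rewrite leq_addl.
- rewrite EE ?leq_addl// -real_normK ?num_real// expr_le1//.
  by have [] := HN _ (leq_addl k N).
- rewrite (_ : (fun k => _) = (fun k => fine (l (k + N)%N) ^+ 2)); last first.
    by apply/funext => k; rewrite EE// leq_addl.
  have lN : (fun k => fine (l (k + N)%N)) @ \oo --> 0 by rewrite (cvg_shiftn N (fine \o l)).
  rewrite (_ : (fun k => _) = (fun k => fine (l (k + N)%N) * fine (l (k + N)%N))).
    have H : (fun k => fine (l (k + N)%N) * fine (l (k + N)%N)) @ \oo --> (0 * 0 : R).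
      exact: (cvgM lN lN).
    by rewrite mulr0 in H.
  by apply/funext => k; rewrite expr2.
Unshelve. all: by end_near.
Qed.

Lemma normal_moment4 :
  Ex (normal_prob 0 1) (fun x : measurableTypeR R => (x : R) ^+ 4) = 3.
Proof.
have tX k : tempered (fun x : R => x ^+ k) by apply: temperedX; exact: tempered_id.
have tcX k : tempered (fun x : R => k.+1%:R * x ^+ k).
  by apply: temperedM => //; exact: tempered_cst.
have I2 := normal_ibp ltr01 (is_derive_exprS 0) (@continuous_derive_exprS R 0) (tX 1%N) (tcX 0%N).
have I4 := normal_ibp ltr01 (is_derive_exprS 2) (@continuous_derive_exprS R 2) (tX 3%N) (tcX 2%N).
rewrite /Ex /Rintegral.
have -> : (\int[normal_prob (0 : R) 1]_x (x ^+ 4)%:E = \int[normal_prob (0 : R) 1]_x (x * x ^+ 3)%:E)%E.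
  by apply: eq_integral => x _; rewrite -exprS.
rewrite I4.
have -> : (\int[normal_prob (0 : R) 1]_x (1 ^+ 2 * (3 * x ^+ 2))%:E =
   \int[normal_prob (0 : R) 1]_x (3%:E * (x ^+ 2)%:E))%E.
  by apply: eq_integral => x _; rewrite expr1n mul1r EFinM.
rewrite integralZl//; last first.
  apply: (integrable_normal ltr01 _ (tX 2%N)); exact: measurable_funX.
have -> : (\int[normal_prob (0 : R) 1]_x (x ^+ 2)%:E = \int[normal_prob (0 : R) 1]_x (x * x ^+ 1)%:E)%E.
  by apply: eq_integral => x _; rewrite -exprS.
rewrite I2.
have -> : (\int[normal_prob (0 : R) 1]_x (1 ^+ 2 * (1 * x ^+ 0))%:E = 1)%E.
  under eq_integral do rewrite expr1n !mul1r expr0.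
  by rewrite integral_cst// mul1e; exact: probability_setT.
by rewrite mule1.
Qed.

End final.

Theorem theorem1p1 (R : realType) (d : measure_display)
    (Omega : measurableType d) (P : probability Omega R)
    (T : R) (T_gt0 : 0 < T) (p : nat) (p_ge2 : (2 <= p)%N)
    (B : R -> {RV P >-> R}) (B_bm : brownian_motion T B)
    (f : nat -> p.-tuple R -> R)
    (f_L2 : forall n, f n \in Lfun (lebesgue_cube T p) 2%:E)
    (f_sym : forall n, symmetric_kernel T (f n))
    (F : nat -> {RV P >-> R})
    (F_int : forall n, is_multiple_integral B T (f n) (F n))
    (F_var : ('E_P[fun w => (F n w ^+ 2)%R] @[n --> \oo] --> 1%:E)%E) :
  cvg_in_distribution F (normal_prob 0 1) <->
  ('E_P[fun w => (F n w ^+ 4)%R] @[n --> \oo] --> 3%:E)%E.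
Proof.
have p0 : (0 < p)%N by exact: ltnW.
have approx n := multiple_integral_chaotic_approx (ltW T_gt0) p0 B_bm (F_int n).
have mF n : measurable_fun setT (F n) by [].
have F2 n : intg P (fun w => F n w ^+ 2).
  by have [Q [cQ iQ _ _]] := approx n; exact: F2_int (mF n) cQ iQ.
have F6 n : intg P (fun w => F n w ^+ 6) /\
    Ex P (fun w => F n w ^+ 6) <= (5 ^+ p * Ex P (fun w => F n w ^+ 2)) ^+ 3.
  by have [Q [cQ iQ _ eQ]] := approx n; exact: F6_le (mF n) cQ iQ eQ.
have F4 n : intg P (fun w => F n w ^+ 4).
  by have [Q [cQ iQ _ eQ]] := approx n; exact: F4_int (mF n) cQ iQ eQ.
have Fstein n (psi : R -> R) (K : R) : continuous psi -> (forall x, `|psi x| <= K) ->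
    (\int[normal_prob 0 1]_x (psi x)%:E = 0)%E -> Ex P (psi \o F n) ^+ 2 <= (2 * K) ^+ 2 *
      (1 - 2 * Ex P (fun w => F n w ^+ 2) + Ex P (fun w => F n w ^+ 4) / 3).
  have [Q [cQ iQ e1 eQ]] := approx n.
  exact: stein_limit_bound (mF n) cQ iQ eQ _ _ e1.
have EE (Y : Omega -> R) : intg P Y -> ('E_P[Y] = (Ex P Y)%:E)%E.
  by move=> iY; rewrite unlock EintE.
have var1 : (fun n => Ex P (fun w => F n w ^+ 2)) @ \oo --> (1 : R).
  by apply/cvg_EFinP; move: F_var; under eq_fun do rewrite EE//.
have -> : ('E_P[fun w => (F n w ^+ 4)%R] @[n --> \oo] --> 3%:E)%E <->
    ((fun n => Ex P (fun w => F n w ^+ 4)) @ \oo --> (3 : R)).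
  rewrite -cvg_EFinP; under eq_fun do rewrite EE//.
  by [].
have iphi (Q : probability Omega R) (Y : Omega -> R) phi (K : R) : continuous phi ->
    (forall x : R, `|phi x| <= K) -> measurable_fun setT Y -> intg P (phi \o Y).
  move=> cphi phiK mY; apply: (intg_le (g := fun=> K)); last exact: intg_cst.
    by apply: measurableT_comp => //; exact: continuous_measurable_fun.
  by move=> w; exact: phiK.
pose gam := normal_prob (0 : R) 1.
have gam_int (h : R -> R) : measurable_fun setT h -> tempered h -> intg gam h.
  by move=> mh th; exact: (integrable_normal ltr01 mh th).
have bnd_tempered (h : R -> R) (K : R) : (forall x, `|h x| <= K) -> tempered h.
  by move=> hK; exists K, 0%N => x; rewrite expr0 mulr1.
split=> [Fdist|F4cvg].
(* (i) => (ii): x^4 is truncated to a bounded continuous test function, and the sixth moments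
   control the error uniformly for large n. *)
- pose phi (m : nat) (x : R) := Num.min (x ^+ 4) (m.+1%:R ^+ 4).
  have cphi m : continuous (phi m) by exact: continuous_truncated_power.
  have phiK m (x : R) : `|phi m x| <= m.+1%:R ^+ 4.
    by apply: truncated_power_bound => //; rewrite exprn_ge0.
  have bphi m : bounded_fun (phi m).
    exists (m.+1%:R ^+ 4); split; first exact: num_real.
    by move=> M HM x _; rewrite /= (le_trans (phiK m x))// ltW.
  (* The difference is nonzero only when x^2 > (m + 1)^2 >= m + 1, and then x^4 <= x^6 / (m + 1). *)
  have phi_dist m (x : R) : `|x ^+ 4 - phi m x| <= m.+1%:R^-1 * x ^+ 6.
    have m1 : 0 < (m.+1%:R : R) by [].
    have x2 := sqr_ge0 x.
    rewrite /phi minEle; case: ifPn => [_|].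
      by rewrite subrr normr0 mulr_ge0 ?invr_ge0 ?exprn_even_ge0// ltW.
    rewrite -ltNge => mx; rewrite ger0_norm ?subr_ge0 ?(ltW mx)//.
    have mx2 : m.+1%:R <= x ^+ 2.
      have : m.+1%:R ^+ 2 <= x ^+ 2 :> R.
        rewrite -(@ler_pXn2r _ 2) ?nnegrE ?sqr_ge0 ?exprn_ge0// -!exprM.
        exact: ltW.
      by apply: le_trans; rewrite expr2 ler_peMl// ler1n.
    apply: (@le_trans _ _ (x ^+ 4)); first by rewrite gerBl exprn_ge0.
    rewrite -(mulKf (lt0r_neq0 m1) (x ^+ 4)) ler_wpM2l ?invr_ge0 ?(ltW m1)//.
    have -> : x ^+ 6 = x ^+ 2 * x ^+ 4 by rewrite -exprD.
    by rewrite ler_wpM2r ?exprn_even_ge0.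
  pose S6 := Ex gam (fun x : R => x ^+ 6).
  have gX j : intg gam (fun x : R => x ^+ j).
    by apply: gam_int; [exact: measurable_funX|apply: temperedX; exact: tempered_id].
  have S60 : 0 <= S6 by apply: Ex_ge0 => x; rewrite exprn_even_ge0.
  have phicvg m : (fun n => Ex P (phi m \o F n)) @ \oo --> Ex gam (phi m).
    apply/cvg_EFinP; have := Fdist (phi m) (cphi m) (bphi m).
    rewrite (EintE (P := gam)); last first.
      by apply: gam_int; [exact: continuous_measurable_fun|exact: bnd_tempered (phiK m)].
    by under eq_fun do rewrite EE ?(iphi _ _ _ _ (cphi m) (phiK m) (mF _))//.
  (* The hypercontractive bound on E[F_n^6] once E[F_n^2] <= 2, which holds for large n. *)
  pose A := (5 ^+ p * 2) ^+ 3 : R.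
  have A0 : 0 <= A by rewrite exprn_ge0// mulr_ge0// exprn_ge0.
  apply/cvgrPdist_le => eps eps0.
  have [m Hm] : exists m : nat, m.+1%:R^-1 * (A + S6) <= eps / 2.
    have AS1 : 0 < A + S6 + 1 by rewrite ltr_wpDl// addr_ge0.
    have [m] := @ltr_add_invr _ 0 (eps / (2 * (A + S6 + 1))) (divr_gt0 eps0 (mulr_gt0 (ltr0n _ 2) AS1)).
    rewrite add0r => Hm; exists m.
    apply: (@le_trans _ _ (m.+1%:R^-1 * (A + S6 + 1))).
      by rewrite ler_wpM2l ?invr_ge0// lerDl.
    by rewrite -ler_pdivlMr// -mulrA -invfM ltW.
  have e20 : 0 < eps / 2 by rewrite divr_gt0.
  move/cvgrPdist_le : (phicvg m) => /(_ _ e20) near1.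
  move/cvgrPdist_le : var1 => /(_ 1 ltr01) near2.
  near=> n.
  have h1 : `|Ex gam (phi m) - Ex P (phi m \o F n)| <= eps / 2 by near: n.
  have h2 : `|1 - Ex P (fun w => F n w ^+ 2)| <= 1 by near: n.
  have F6A : Ex P (fun w => F n w ^+ 6) <= A.
    apply: le_trans (F6 n).2 _; rewrite /A lerXn2r ?nnegrE ?mulr_ge0 ?exprn_ge0//.
      by apply: Ex_ge0 => w; exact: sqr_ge0.
    by rewrite ler_wpM2l ?exprn_ge0//; move: h2; rewrite ler_norml => /andP[]; lra.
  have d1 : `|Ex P (fun w => F n w ^+ 4) - Ex P (phi m \o F n)| <= m.+1%:R^-1 * A.
    apply: (@le_trans _ _ (Ex P (fun w => m.+1%:R^-1 * F n w ^+ 6))).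
      apply: Eint_dist => //; first exact: iphi (cphi m) (phiK m) (mF n).
        by apply: intgZ; exact: (F6 n).1.
      by move=> w; exact: phi_dist.
    by rewrite EintZ ?ler_wpM2l ?invr_ge0//; exact: (F6 n).1.
  have d2 : `|3 - Ex gam (phi m)| <= m.+1%:R^-1 * S6.
    rewrite -normal_moment4 -/gam /S6 -EintZ; last exact: gX.
    apply: Eint_dist; [exact: gX| |apply: intgZ; exact: gX|exact: phi_dist].
    by apply: gam_int; [exact: continuous_measurable_fun|exact: bnd_tempered (phiK m)].
  move: d1 d2 h1 Hm; rewrite mulrDr !ler_norml.
  set a4 := Ex P _; set b := Ex P _; set c := Ex gam _.
  move: a4 b c => a4 b c; move: (_ * A) (_ * S6) => u v.
  move=> /andP[? ?] /andP[? ?] /andP[? ?] ?.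
  by apply/andP; split; lra.
(* (ii) => (i): Stein's bound asks for mean 0 under the Gaussian law, so [phi] is centred by its
   Gaussian mean [c]. Boundedness gives a bound for every value above [M0], hence [M0 + 1]. *)
- move=> phi cphi [M0 [_ HM]].
  have phiK x : `|phi x| <= M0 + 1 by apply: HM => //; rewrite ltrDl.
  have mphi := continuous_measurable_fun cphi.
  have igam := gam_int phi mphi (bnd_tempered _ _ phiK).
  pose c := Ex gam phi; pose psi x := phi x - c.
  have cpsi : continuous psi by move=> x; apply: cvgB; [exact: cphi|exact: cvg_cst].
  pose K := M0 + 1 + `|c|.
  have psiK x : `|psi x| <= K by rewrite (le_trans (ler_normB _ _))// lerD.
  have Ipsi : (\int[normal_prob 0 1]_x (psi x)%:E = 0)%E.
    rewrite (EintE (P := gam)); last by apply: intgB => //; exact: intg_cst.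
    by rewrite EintB ?Ex_cst ?subrr//; exact: intg_cst.
  rewrite (EintE (P := gam))// -/c.
  have iF n : intg P (phi \o F n) by exact: iphi cphi phiK (mF n).
  under eq_fun do rewrite EE//.
  apply/cvg_EFinP; apply/cvgrPdist_le => eps eps0.
  have bcvg : (fun n => (2 * K) ^+ 2 * (1 - 2 * Ex P (fun w => F n w ^+ 2) +
      Ex P (fun w => F n w ^+ 4) / 3)) @ \oo --> (2 * K) ^+ 2 * (1 - 2 * 1 + 3 / 3).
    apply: cvgM; first exact: cvg_cst.
    apply: cvgD; last by apply: cvgM; [exact: F4cvg|exact: cvg_cst].
    by apply: cvgB; [exact: cvg_cst|apply: cvgM; [exact: cvg_cst|exact: var1]].
  rewrite (_ : _ * (1 - 2 * 1 + 3 / 3) = 0) in bcvg; last by field.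
  have eps2 : 0 < eps ^+ 2 by rewrite exprn_gt0.
  move/cvgrPdist_le : bcvg => /(_ _ eps2); apply: filterS => n.
  rewrite sub0r normrN => le_eps.
  have Epsi : Ex P (psi \o F n) = Ex P (phi \o F n) - c.
    rewrite -[in RHS](Ex_cst P c) -EintB//; exact: intg_cst.
  rewrite distrC -Epsi -(@ler_pXn2r _ 2) ?nnegrE ?(ltW eps0)// real_normK ?num_real//.
  apply: le_trans (Fstein n psi K cpsi psiK Ipsi) _.
  exact: le_trans (ler_norm _) le_eps.
Unshelve. all: by end_near.
Qed.
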